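(* Let $\lambda$ be a regular uncountable cardinal, let $S\subseteq S^\lambda_{\aleph_0}$ be a stationary non-reflecting subset of $\lambda$, and suppose $\diamondsuit_S$ holds. Let either $\mu=\lambda$ or $\mu=2^\lambda$, and let $R\subseteq\mu\times\mu$ be any relation. Then there are sequences $\langle\mathbb G_\alpha:\alpha<\mu\rangle$ and $\langle\mathbb K_\alpha:\alpha<\mu\rangle$ of $\lambda$-free abelian groups such that $|\mathbb G_\alpha|=\lambda$ and $|\mathbb K_\alpha|=2^\lambda$ for all $\alpha<\mu$, and for all $\alpha,\beta<\mu$: $$\mathrm{Ext}(\mathbb G_\alpha,\mathbb K_\beta)=0\iff (\alpha,\beta)\in R.$$
   Context: $\mathrm{Ext}=\mathrm{Ext}^1_{\mathbb Z}$. $S^\lambda_{\aleph_0}=\{\alpha<\lambda:\mathrm{cf}(\alpha)=\aleph_0\}$. A stationary $S\subseteq\lambda$ is non-reflecting if for no limit $\delta<\lambda$ of uncountable cofinality is $S\cap\delta$ stationary in $\delta$. $\diamondsuit_S$ asserts there is a sequence $\langle S_\alpha:\alpha\in S\rangle$, $S_\alpha\subseteq\alpha$, such that for every $X\subseteq\lambda$ the set $\{\alpha\in S:X\cap\alpha=S_\alpha\}$ is stationary. An abelian group is $\lambda$-free if every subgroup of cardinality $<\lambda$ is free. *)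

(* Defs.v *)
(* Ordinals below lambda are modelled by a well-ordered type
   (O, lt); an ordinal alpha < lambda is an element of O, identified with its
   initial segment {beta | lt beta alpha}. *)
From mathcomp Require Import all_boot all_algebra.
Set Implicit Arguments. Unset Strict Implicit. Unset Printing Implicit Defensive.
Import GRing.Theory.
Local Open Scope ring_scope.

Section Ordinals.
Variables (O : Type) (lt : O -> O -> Prop).

Definition well_order : Prop :=
  [/\ forall a, ~ lt a a,
      forall a b c, lt a b -> lt b c -> lt a c,
      forall a b, lt a b \/ a = b \/ lt b a
    & well_founded lt].

Definition is_cardinal : Prop :=
  forall a, ~ exists f : O -> {b | lt b a}, injective f.

Definition unbounded (X : O -> Prop) : Prop :=
  forall b, exists c, X c /\ lt b c.

Definition regular_uncountable_cardinal : Prop :=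
  [/\ is_cardinal,
      (forall X : O -> Prop, unbounded X -> exists f : O -> {x | X x}, injective f)
    & ~ exists f : O -> nat, injective f].


Definition limit_ord (d : O) : Prop :=
  (exists b, lt b d) /\ (forall b, lt b d -> exists c, lt b c /\ lt c d).

Definition cof_omega (a : O) : Prop :=
  exists f : nat -> O,
    [/\ forall n, lt (f n) (f n.+1), forall n, lt (f n) a
      & forall b, lt b a -> exists n, lt b (f n)].

(* closed unbounded subset of the downward closed set D (D = everything for
   lambda itself, D = {b | lt b d} for an ordinal d < lambda) *)
Definition club (D C : O -> Prop) : Prop :=
  [/\ forall c, C c -> D c,
      (forall b, D b -> exists c, C c /\ lt b c)
    & forall g, D g -> limit_ord g ->
        (forall b, lt b g -> exists c, [/\ C c, lt b c & lt c g]) -> C g].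

Definition stationary (D S : O -> Prop) : Prop :=
  forall C, club D C -> exists a, S a /\ C a.

Definition non_reflecting (S : O -> Prop) : Prop :=
  forall d, limit_ord d -> ~ cof_omega d ->
    ~ stationary (fun b => lt b d) (fun b => S b /\ lt b d).

Definition diamond (S : O -> Prop) : Prop :=
  exists g : O -> O -> Prop,
    (forall a b, S a -> g a b -> lt b a) /\
    forall X : O -> Prop,
      stationary (fun _ => True)
        (fun a => S a /\ forall b, lt b a -> (X b <-> g a b)).

End Ordinals.

Definition subgroup (A : zmodType) (H : A -> Prop) : Prop :=
  [/\ H 0, forall x y, H x -> H y -> H (x + y) & forall x, H x -> H (- x)].

Definition free_basis (A : zmodType) (H B : A -> Prop) : Prop :=
  [/\ forall b, B b -> H b,
      (forall x, H x -> exists (s : seq A) (c : A -> int),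
          (forall a, a \in s -> B a) /\ x = \sum_(a <- s) a *~ c a)
    & forall (s : seq A) (c : A -> int), uniq s -> (forall a, a \in s -> B a) ->
          \sum_(a <- s) a *~ c a = 0 -> forall a, a \in s -> c a = 0].

Definition free_subgroup (A : zmodType) (H : A -> Prop) : Prop :=
  exists B, free_basis H B.

Definition lambda_free (O : Type) (A : zmodType) : Prop :=
  forall H : A -> Prop, subgroup H ->
    ~ (exists f : O -> A, injective f /\ forall o, H (f o)) ->
    free_subgroup H.

Definition additive_fun (U V : zmodType) (f : U -> V) : Prop :=
  forall x y, f (x - y) = f x - f y.

Definition Ext_zero (G K : zmodType) : Prop :=
  forall (E : zmodType) (i : K -> E) (p : E -> G),
    additive_fun i -> additive_fun p -> injective i -> (forall x, exists e, p e = x) ->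
    (forall e, p e = 0 <-> exists k, i k = e) ->
    exists s : G -> E, additive_fun s /\ forall x, p (s x) = x.

(* Main.v *)
(* For a ladder system [eta] on the points of [S] and a set [P] of such points let [G_P] be
   generated by [u x] and [v d n] subject to [2 v(d, n+1) = v(d, n) + u(eta d n)] for [d] in [P].
   Then [Ext (G_P, K) = 0] iff all recursions [2 v(d, n+1) = v(d, n) + u(eta d n) + a(d, n)], with
   [a] in [K], are solvable in [K]. For a set [A] of ordinals, take as [P] the set [S_A] of those
   points where the diamond sequence guesses [A]; these sets are stationary and almost disjoint.
   Given a family of sets [A], let [K] be the group freely generated by one solution of each
   recursion over the corresponding [S_A] with coefficients in [K] itself, so that [Ext] vanishes
   for this family. As [S] does not reflect, below any ordinal the ladders have disjoint tails;
   this exhibits explicit bases of an increasing cover of [G_P] and [K], hence [lambda]-freeness.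
   If [A] is not in the family, guess at [d] in [S_A] also the values of [u] below [d] in
   a filtration of [K], and let [a] be [0], or the sequence [e, 0, e, 0, ...] if the guess admits
   a solution of the homogeneous recursion along the ladder at [d]. A correct guess at a closed
   enough [d] is refuted: as [d] lies in no [S_B] relevant below [d], solutions at [d] stay in the
   filtration, and the difference of two solutions would make [e/3] an element of [K]. *)
From HB Require Import structures.
Require Import Defs.
From mathcomp Require Import all_boot all_order all_algebra.
From mathcomp Require Import boolp zify ring lra.
From mathcomp Require wochoice classical_sets functions cardinality.
Set Implicit Arguments. Unset Strict Implicit. Unset Printing Implicit Defensive.
Import Order.TTheory GRing.Theory Num.Theory.
Local Open Scope ring_scope.

Section Injections.
Import classical_sets functions cardinality.

Lemma injections_bijective (T U : Type) (f : T -> U) (g : U -> T) :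
  injective f -> injective g -> exists h : T -> U, bijective h.
Proof.
move=> fI gI.
have le (V W : Type) (k : V -> W) : injective k -> card_le [set: V] [set: W].
  move=> kI; have /injfunPex [h] : exists2 k : V -> W,
    set_fun [set: V] [set: W] k & set_inj [set: V] k by exists k => // x y _ _ /kI.
  exact: inj_card_le h.
have /card_bijP [h hB] := Cantor_Bernstein (le _ _ f fI) (le _ _ g gI).
exists (\val \o h \o @to_setT T); apply: bij_comp; last by rewrite -setTT_bijective.
apply: bij_comp => //; exists (@to_setT U) => x //; exact: val_inj.
Qed.

Lemma uncountable_nat_injection (T : Type) :
  (~ exists f : T -> nat, injective f) -> exists f : nat -> T, injective f.
Proof.
move=> NT; have /infiniteP : infinite_set [set: T].
  move=> /finite_set_countable /countable_injP [f fI].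
  by apply: NT; exists f => x y; apply: fI; rewrite in_setT.
move=> /card_leP [f]; exists (\val \o f \o @to_setT nat) => m n /= /val_inj.
by move=> /inj; rewrite !in_setT => /(_ isT isT) /(congr1 \val).
Qed.

End Injections.

(** * Clubs, ladders and pairing *)

Lemma sval_injective (T : Type) (P : T -> Prop) : injective (@sval T P).
Proof. by move=> [x p] [y q] /= E; apply: eq_exist. Qed.

Section RegularCardinal.
Variables (O : Type) (lt : O -> O -> Prop).
Hypothesis Hwo : well_order lt.
Hypothesis Hreg : regular_uncountable_cardinal lt.

Lemma lt_irr a : ~ lt a a. Proof. by case: Hwo. Qed.
Lemma lt_tr b a c : lt a b -> lt b c -> lt a c.
Proof. by case: Hwo => _ tr _ _; apply: tr. Qed.
Lemma le_lt_tr b a c : ~ lt b a -> lt b c -> lt a c.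
Proof.
case: Hwo => _ tr tot _ ab bc.
by case: (tot a b) => [ab'|[->//|/ab//]]; apply: tr bc.
Qed.
Lemma lt_le_tr b a c : lt a b -> ~ lt c b -> lt a c.
Proof.
case: Hwo => _ tr tot _ ab bc.
by case: (tot b c) => [bc'|[<-//|/bc//]]; apply: tr bc'.
Qed.
Lemma lt_tot a b : lt a b \/ a = b \/ lt b a. Proof. by case: Hwo. Qed.
Lemma ord_lt_asym a b : lt a b -> ~ lt b a.
Proof. by move=> ab /(lt_tr ab) /lt_irr. Qed.
Lemma lt_wf : well_founded lt. Proof. by case: Hwo. Qed.

Lemma ord_min (P : O -> Prop) :
  (exists x, P x) -> exists x, P x /\ forall y, P y -> ~ lt y x.
Proof.
move=> [x Px]; apply: contrapT => N; suff: forall y, ~ P y by move/(_ x Px).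
apply: (well_founded_ind lt_wf) => y IH Py; apply: N; exists y; split=> // z Pz zy.
exact: IH zy Pz.
Qed.

Lemma ord_inhabited : inhabited O.
Proof.
case: Hreg => _ _ N; apply: contrapT => NO; apply: N.
by exists (fun=> 0%N) => x; case: NO; constructor.
Qed.

Lemma ord_no_max b : exists c, lt b c.
Proof.
apply: contrapT => bmax; case: Hreg => card _ /uncountable_nat_injection[f fI].
have {}bmax c : c <> b -> lt c b.
  by case: (lt_tot c b) => [//|[//|bc]] _; case: bmax; exists c.
have [g gI gb] : exists2 g : nat -> O, injective g & forall n, g n <> b.
  have [[k fk]|N] := pselect (exists k, f k = b); last first.
    by exists f => // n fn; apply: N; exists n.
  exists (fun n => f (n + k.+1)%N) => [m n /fI /addIn //|n].
  by rewrite -fk => /fI; lia.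
pose h x := if pselect (x = b) is left _ then g 0%N else
  if pselect (exists n, g n = x) is left e then g (projT1 (cid e)).+1 else x.
have hb x : h x <> b.
  by rewrite /h; case: pselect => [_|xb]; [|case: pselect => [e|//]]; apply: gb.
case: (card b); exists (fun x => exist (fun c => lt c b) (h x) (bmax _ (hb x))).
move=> x y /(congr1 sval) /=.
rewrite /h; case: (pselect (x = b)) => [->|xb]; case: (pselect (y = b)) => [->|yb] //.
- by case: pselect => [e /gI //|N E]; case: N; exists 0%N.
- by case: pselect => [e /gI //|N E]; case: N; exists 0%N.
case: (pselect (exists n, g n = x)) => [ex|Nx]; case: (pselect (exists n, g n = y)) => [ey|Ny] //.
- by case: cid => m /= <-; case: cid => n /= <- /gI [->].
- by move=> E; case: Ny; eexists; exact: E.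
- by move=> E; case: Nx; eexists; exact: esym E.
Qed.

Definition bounded_index (I : Type) := forall f : I -> O, exists b, forall i, lt (f i) b.

Lemma bounded_index_no_injection (I : Type) :
  (~ exists f : O -> I, injective f) -> bounded_index I.
Proof.
move=> NI f; apply: contrapT => Nb; apply: NI.
case: Hreg => _ reg _; case: (reg (fun x => exists i, f i = x)).
  move=> b; apply: contrapT => N; have [c bc] := ord_no_max b.
  apply: Nb; exists c => i; apply: le_lt_tr bc => bi; apply: N.
  by exists (f i); split=> //; exists i.
move=> g gI; have /choice [i fi] : forall o, exists i, f i = sval (g o).
  by move=> o; case: (g o).
by exists i => x y E; apply: gI; apply: sval_injective; rewrite -!fi E.
Qed.

Lemma bounded_index_segment b : bounded_index {x | lt x b}.
Proof. by apply: bounded_index_no_injection; case: Hreg. Qed.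

Lemma bounded_index_nat : bounded_index nat.
Proof. by apply: bounded_index_no_injection; case: Hreg. Qed.

Lemma bounded_index_surj (I J : Type) (p : I -> J) :
  bounded_index I -> (forall j, exists i, p i = j) -> bounded_index J.
Proof.
move=> bI ps f; have [b fb] := bI (f \o p).
by exists b => j; have [i <-] := ps j; apply: fb.
Qed.

Lemma bounded_index_unit : bounded_index unit.
Proof.
exact: bounded_index_surj (fun=> tt) bounded_index_nat (fun 'tt => ex_intro _ 0%N erefl). Qed.

Lemma ord_max2 a b : exists c, lt a c /\ lt b c.
Proof.
have [c hc] := bounded_index_nat (fun n => if n is 0 then a else b).
by exists c; split; [apply: (hc 0%N)|apply: (hc 1%N)].
Qed.

Lemma bounded_index_dep (I : Type) (J : I -> Type) :
  bounded_index I -> (forall i, bounded_index (J i)) -> bounded_index {i : I & J i}.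
Proof.
move=> bI bJ f.
have /choice [b hb] : forall i, exists b, forall j, lt (f (existT _ i j)) b.
  by move=> i; apply: bJ.
by have [c hc] := bI b; exists c => -[i j]; apply: lt_tr (hb i j) (hc i).
Qed.

Local Notation clubO := (club lt (fun=> True)).

(* The index type of the requirements at [g] is a bounded family that grows
   continuously: a requirement active at a limit is active earlier. *)
Lemma club_inter (I : Type) (act : I -> O -> Prop) (C : I -> O -> Prop) :
  (forall b, bounded_index {i | act i b}) ->
  (forall i a b, act i a -> lt a b -> act i b) ->
  (forall i b, act i b -> limit_ord lt b -> exists a, lt a b /\ act i a) ->
  (forall i, clubO (C i)) ->
  clubO (fun b => limit_ord lt b /\ forall i, act i b -> C i b).
Proof.
move=> bact mono cont CC; split=> // [b0 _|g _ glim gcof]; last first.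
  split=> // i ig; have [a [ag ia]] := cont _ _ ig glim.
  have [_ _ clos] := CC i; apply: clos => // b bg.
  have [c [ac bc cg]] : exists c, [/\ lt a c, lt b c & lt c g].
    have [c [[_ _] ac cg]] := gcof a ag; have [d [[_ _] bd dg]] := gcof b bg.
    case: (lt_tot c d) => [cd|[cd|dc]]; [exists d|exists d|exists c]; split=> //.
    - exact: lt_tr ac cd.
    - by rewrite -cd.
    - exact: lt_tr bd dc.
  have [d [[dlim dC] cd dg]] := gcof c cg.
  exists d; split=> //; last exact: lt_tr bc cd.
  by apply: dC; apply: mono ia _; apply: lt_tr ac cd.
have step b : exists c, lt b c /\ forall i, act i b -> exists d, [/\ C i d, lt b d & lt d c].
  have /choice [d hd] : forall i : {i | act i b}, exists d, C (sval i) d /\ lt b d.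
    by move=> [i ib]; have [_ unb _] := CC i; apply: unb.
  have [c1 hc1] := bact b d; have [c [bc c1c]] := ord_max2 b c1.
  exists c; split=> // i ib; exists (d (exist _ i ib)).
  have [? ?] := hd (exist _ i ib); split=> //; exact: lt_tr (hc1 _) c1c.
have {step} [nxt /all_and2 [lt_nxt nxtP]] := choice step.
pose s n := iter n nxt b0.
have ss n : lt (s n) (s n.+1) by apply: lt_nxt.
have [g [sg gmin]] : exists g, (forall n, lt (s n) g) /\
    forall y, (forall n, lt (s n) y) -> ~ lt y g.
  by apply: ord_min; apply: bounded_index_nat.
have gcof b : lt b g -> exists n, lt b (s n).
  move=> bg; apply: contrapT => N; apply: gmin bg => n.
  apply: lt_le_tr (ss n) _ => bn; apply: N; by exists n.+1.
have glim : limit_ord lt g.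
  split=> [|b /gcof [n bn]]; [by exists (s 0%N)|by exists (s n)].
exists g; split; last exact: (sg 0%N).
split=> // i ig; have [a [ag ia]] := cont _ _ ig glim.
have [_ _ clos] := CC i; apply: clos => // b /gcof [n bn].
have [m am] := gcof _ ag.
have mle k j : (k <= j)%N -> ~ lt (s j) (s k).
  elim: j => [|j IH]; first by rewrite leqn0 => /eqP->; apply: lt_irr.
  rewrite leq_eqVlt => /orP[/eqP->|]; first exact: lt_irr.
  by rewrite ltnS => /IH kj jk; apply: kj; apply: lt_tr (ss j) jk.
have [d [Cd sd ds]] : exists d, [/\ C i d, lt (s (maxn n m)) d & lt d (s (maxn n m).+1)].
  by apply: nxtP; apply: mono ia _; apply: lt_le_tr am _; apply: mle; apply: leq_maxr.
exists d; split=> //; last exact: lt_tr ds (sg _).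
by apply: lt_tr sd; apply: lt_le_tr bn _; apply: mle; apply: leq_maxl.
Qed.

Lemma club_and (C D : O -> Prop) : clubO C -> clubO D ->
  clubO (fun b => [/\ limit_ord lt b, C b & D b]).
Proof.
move=> CC DC.
have bB (b : O) : bounded_index {i : bool | True}.
  apply: bounded_index_surj (fun n => exist _ (n == 0%N) I) bounded_index_nat _.
  by move=> [[] []]; [exists 0%N|exists 1%N].
have [] // := @club_inter bool (fun _ _ => True) (fun i => if i then C else D) bB.
  by move=> i b _ [[a ab] _]; exists a.
  by case.
move=> _ unb clos; split=> // [b _|g _ glim gcof].
  have [c [[cl cP] bc]] := unb b I; exists c; split=> //.
  by split=> //; [apply: (cP true)|apply: (cP false)].
case: (clos g I glim).
  move=> b bg; have [c [[cl Cc Dc] bc cg]] := gcof b bg.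
  by exists c; split=> //; split=> // -[].
by move=> _ P; split=> //; [apply: (P true)|apply: (P false)].
Qed.

Lemma club_True : clubO (fun=> True).
Proof. by split=> // b _; have [c bc] := ord_no_max b; exists c. Qed.

Lemma club_above b : clubO (fun c => lt b c).
Proof.
split=> // [a _|g _ [[a ag] _] gcof]; first by have [c []] := ord_max2 b a; exists c.
by have [c [bc _ cg]] := gcof a ag; apply: lt_tr bc cg.
Qed.

Lemma club_closure (J : Type) (Q : O -> O -> J -> O -> Prop) :
  bounded_index J -> (forall x y j, exists z, Q x y j z) ->
  clubO (fun d => limit_ord lt d /\
    forall x y j, lt x d -> lt y d -> exists z, lt z d /\ Q x y j z).
Proof.
move=> bJ tot.
have Cx x y j : clubO (fun d => exists z, lt z d /\ Q x y j z).
  have [z0 Qz] := tot x y j; split=> // [b _|g _ [[a ag] _] gcof].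
    have [c [zc bc]] := ord_max2 z0 b; exists c; split=> //.
    by exists z0.
  have [c [[z [zc ?]] _ cg]] := gcof a ag; exists z; split=> //; exact: lt_tr zc cg.
have [] // := @club_inter (O * O * J) (fun i d => lt i.1.1 d /\ lt i.1.2 d)
  (fun i d => exists z, lt z d /\ Q i.1.1 i.1.2 i.2 z).
- move=> b; pose p (i : {x : {x | lt x b} & {y : {y | lt y b} & J}}) :
    {i : O * O * J | lt i.1.1 b /\ lt i.1.2 b} :=
    exist _ (sval (projT1 i), sval (projT1 (projT2 i)), projT2 (projT2 i))
     (conj (proj2_sig (projT1 i)) (proj2_sig (projT1 (projT2 i)))).
  apply: (@bounded_index_surj _ _ p).
    apply: bounded_index_dep => [|_]; first exact: bounded_index_segment.
    apply: bounded_index_dep => [|_]; first exact: bounded_index_segment.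
    exact: bJ.
  move=> [[[x y] j] [/= xb yb]].
  exists (existT _ (exist _ x xb) (existT _ (exist _ y yb) j)); exact: sval_injective.
- move=> [[x y] j] a b /= [xa ya] ab; split; exact: lt_tr ab.
- move=> [[x y] j] b /= [xb yb] [_ lim].
  have [c [xc cb]] := lim _ xb; have [d [yd db]] := lim _ yb.
  case: (lt_tot c d) => [cd|[cd|dc]]; [exists d|exists d|exists c]; split=> //; split=> //.
  + exact: lt_tr xc cd.
  + by rewrite -cd.
  + exact: lt_tr yd dc.
move=> _ unb clos; split=> // [b _|g _ glim gcof].
  have [c [[cl cP] bc]] := unb b I; exists c; split=> //; split=> // x y j xc yc.
  exact: (cP (x, y, j)).
case: (clos g I glim).
  move=> b bg; have [c [[cl Cc] bc cg]] := gcof b bg.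
  by exists c; split=> //; split=> // -[[x y] j] /= [xc yc]; apply: Cc.
by move=> _ P; split=> // x y j xg yg; apply: (P (x, y, j)).
Qed.

End RegularCardinal.

Section Ladders.
Variables (O : Type) (lt : O -> O -> Prop).
Hypothesis Hwo : well_order lt.
Hypothesis Hreg : regular_uncountable_cardinal lt.
Variables (S : O -> Prop) (eta : O -> nat -> O).

Definition ladder (d : O) (f : nat -> O) :=
  [/\ forall n, lt (f n) (f n.+1), forall n, lt (f n) d
    & forall b, lt b d -> exists n, lt b (f n)].

Hypothesis etaP : forall d, S d -> ladder d (eta d).
Hypothesis HSnr : non_reflecting lt S.

Local Notation lt_tr := (lt_tr Hwo).
Local Notation lt_irr := (lt_irr Hwo).

Lemma ladder_lt d f m n : ladder d f -> (m < n)%N -> lt (f m) (f n).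
Proof.
case=> up _ _; elim: n => // n IH; rewrite ltnS leq_eqVlt => /orP[/eqP->//|/IH mn].
exact: lt_tr mn (up n).
Qed.

Lemma ladder_inj d f : ladder d f -> injective f.
Proof.
move=> fP m n E; have [mn|nm|//] := ltngtP m n.
  by have := ladder_lt fP mn; rewrite E => /lt_irr.
by have := ladder_lt fP nm; rewrite E => /lt_irr.
Qed.

Lemma ladder_eventually d f b : ladder d f -> lt b d ->
  exists m, forall n, (m <= n)%N -> lt b (f n).
Proof.
move=> fP bd; have [_ _ cof] := fP; have [m bm] := cof b bd.
exists m => n; rewrite leq_eqVlt => /orP[/eqP<-//|mn].
exact: lt_tr bm (ladder_lt fP mn).
Qed.

Lemma ladder_limit d f : ladder d f -> limit_ord lt d.
Proof.
move=> [_ fd cof]; split; first by exists (f 0%N).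
by move=> b /cof[n bn]; exists (f n).
Qed.

Lemma S_limit d : S d -> limit_ord lt d.
Proof. by move=> /etaP/ladder_limit. Qed.

Definition disjoint_tails (g : O) (h : O -> nat) :=
  forall d d' m n, S d -> S d' -> lt d g -> lt d' g -> (h d <= m)%N -> (h d' <= n)%N ->
    eta d m = eta d' n -> d = d'.

Lemma disjoint_tails_of_lt g h :
  (forall d d' m n, S d -> S d' -> lt d g -> lt d' g -> (h d <= m)%N -> (h d' <= n)%N ->
    lt d d' -> eta d m <> eta d' n) -> disjoint_tails g h.
Proof.
move=> H d d' m n Sd Sd' dg d'g hm hn E.
have [dd'|[//|dd']] := lt_tot Hwo d d'.
  by case: (H d d' m n).
by case: (H d' d n m).
Qed.

(* The intervals between consecutive points of [C] are treated independently: the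
   ladder of a point of [S] can be truncated to its own interval. *)
Lemma disjoint_tails_glue g (C : O -> Prop) :
  (forall c, lt c g -> exists h, disjoint_tails c h) ->
  (forall c, C c -> lt c g) -> (forall b, lt b g -> exists c, C c /\ lt b c) ->
  (forall c, C c -> ~ S c) ->
  (forall d, S d -> lt d g -> exists b, lt b d /\ forall c, C c -> lt c d -> ~ lt b c) ->
  exists h, disjoint_tails g h.
Proof.
move=> IH Cg Ccof CS Csep.
have /choice [H HP] : forall c, exists h, lt c g -> disjoint_tails c h.
  by move=> c; have [/IH[h ?]|] := pselect (lt c g); [exists h|exists (fun=> 0%N)].
have /choice [h hP] : forall d, exists k : nat, S d -> lt d g -> exists c,
    [/\ C c, lt d c, forall c', C c' -> lt d c' -> ~ lt c' c, (H c d <= k)%N &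
     forall n, (k <= n)%N -> forall c', C c' -> lt c' d -> lt c' (eta d n)].
  move=> d; have [[Sd dg]|N] := pselect (S d /\ lt d g); last by exists 0%N => *; case: N.
  have [c [[Cc dc] cmin]] := ord_min Hwo (Ccof d dg).
  have [b [bd bC]] := Csep d Sd dg; have [m mP] := ladder_eventually (etaP Sd) bd.
  exists (maxn (H c d) m) => _ _; exists c; split=> //.
  - by move=> c' Cc' dc'; apply: cmin.
  - exact: leq_maxl.
  - move=> n; rewrite geq_max => /andP[_ /mP bn] c' Cc' c'd.
    by apply: (le_lt_tr Hwo) bn; apply: bC.
exists h; apply: disjoint_tails_of_lt => d d' m n Sd Sd' dg d'g hm hn dd' E.
have [c [Cc dc cmin Hc _]] := hP d Sd dg.
have [c' [Cc' dc' cmin' Hc' above]] := hP d' Sd' d'g.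
have [cc'|[cc'|cc']] := lt_tot Hwo c c'.
- have cd' : lt c d'.
    case: (lt_tot Hwo c d') => [//|[cd'|d'c]]; first by case: (CS c Cc); rewrite cd'.
    by case: (cmin' c).
  have := above n hn c Cc cd'; rewrite -E => cm.
  have [_ /(_ m) md _] := etaP Sd.
  by apply: (@lt_irr c); apply: lt_tr cm (lt_tr md dc).
- have dE : d = d'.
    apply: (HP c (Cg c Cc) d d' m n) => //; rewrite ?cc' //; last exact: leq_trans Hc' hn.
    by apply: leq_trans hm; rewrite -cc'.
  by move: dd'; rewrite dE => /lt_irr.
- by case: (cmin c' Cc' _ cc'); apply: lt_tr dd' dc'.
Qed.

Lemma exists_disjoint_tails g : exists h, disjoint_tails g h.
Proof.
elim/(well_founded_ind (lt_wf Hwo)): g => g IH.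
have [[b bg]|N] := pselect (exists b, lt b g); last first.
  by exists (fun=> 0%N) => d d' m n _ _ dg; case: N; exists d.
have [glim|] := pselect (limit_ord lt g); last first.
  move=> Nlim; have [p [pg pmax]] : exists p, lt p g /\ forall c, lt c g -> ~ lt p c.
    apply: contrapT => N; apply: Nlim; split=> [|c cg]; first by exists b.
    apply: contrapT => Nc; apply: N; exists c; split=> // d dg cd.
    by apply: Nc; exists d.
  have [h hP] := IH p pg.
  have /choice [k kP] : forall d, exists k : nat, S d -> S p -> lt d p -> forall m n,
      (k <= m)%N -> eta d m <> eta p n.
    move=> d; have [[Sd Sp dp]|N] := pselect [/\ S d, S p & lt d p]; last first.
      by exists 0%N => *; case: N.
    have [_ etad _] := etaP Sd; have etapP := etaP Sp.
    have [j dj] := ladder_eventually etapP dp.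
    suff [k kP] : exists k, forall n, (n < j)%N -> forall m, (k <= m)%N -> eta d m <> eta p n.
      exists k => _ _ _ m n km E; have [nj|jn] := ltnP n j; first exact: kP E.
      have := dj n jn; rewrite -E => /lt_tr/(_ (etad m)); exact: lt_irr.
    elim: j {dj} => [|j [k kP]]; first by exists 0%N.
    have [[i iE]|N] := pselect (exists i, eta d i = eta p j).
      exists (maxn k i.+1) => n; rewrite ltnS leq_eqVlt => /orP[/eqP-> m|nj m].
        rewrite geq_max -iE => /andP[_ im] /(ladder_inj (etaP Sd)) mi.
        by move: im; rewrite mi ltnn.
      by rewrite geq_max => /andP[km _]; apply: kP.
    exists k => n; rewrite ltnS leq_eqVlt => /orP[/eqP-> m _ E|]; last exact: kP.
    by apply: N; exists m.
  have ltp d : lt d g -> d <> p -> lt d p.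
    by move=> dg dp; case: (lt_tot Hwo d p) => [//|[//|/(pmax _ dg)]].
  exists (fun d => maxn (h d) (k d)); apply: disjoint_tails_of_lt => d d' m n Sd Sd' dg d'g.
  rewrite !geq_max => /andP[hm km] /andP[hn kn] dd'.
  have dp : lt d p.
    by apply: ltp => // dp; apply: (pmax d' d'g); rewrite -dp.
  have [d'E|/(ltp _ d'g) d'p] := pselect (d' = p).
    by rewrite d'E; apply: kP => //; rewrite -d'E.
  move=> /(hP d d' m n Sd Sd' dp d'p hm hn) dE.
  by move: dd'; rewrite dE => /lt_irr.
have [[f [fup fg fcof]]|gcof] := pselect (cof_omega lt g).
  have /choice [s sP] : forall n, exists s, lt (f n) s /\ forall y, lt (f n) y -> ~ lt y s.
    by move=> n; apply: (ord_min Hwo); exists (f n.+1).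
  have sg n : lt (s n) g.
    by apply: (le_lt_tr Hwo) (fg n.+1); apply: (proj2 (sP n)).
  apply: (disjoint_tails_glue (C := fun c => exists n, s n = c)) => //.
  - by move=> c [n <-].
  - move=> a /fcof [n an]; exists (s n); split; first by exists n.
    exact: lt_tr an (proj1 (sP n)).
  - move=> c [n <-] /S_limit [_ lim].
    have [c' [nc' c's]] := lim _ (proj1 (sP n)); exact: proj2 (sP n) _ nc' c's.
  - move=> d Sd dg; have [k dk] := fcof d dg; have [[b0 b0d] _] := S_limit Sd.
    have fP : ladder g f by split.
    suff [a [ad aP]] : exists a, lt a d /\ forall n, (n <= k)%N -> lt (s n) d -> ~ lt a (s n).
      exists a; split=> // _ [n <-] nd; apply: aP => //; rewrite leqNgt; apply/negP => kn.
      apply: (@lt_irr d); apply: lt_tr dk _.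
      by apply: lt_tr (ladder_lt fP kn) _; apply: lt_tr (proj1 (sP n)) nd.
    elim: k {dk} => [|k [a [ad aP]]].
      have [sd|Nsd] := pselect (lt (s 0%N) d); last first.
        by exists b0; split=> // n; rewrite leqn0 => /eqP->.
      by exists (s 0%N); split=> // n; rewrite leqn0 => /eqP-> _; apply: lt_irr.
    have [sd|Nsd] := pselect (lt (s k.+1) d); last first.
      by exists a; split=> // n; rewrite leq_eqVlt => /orP[/eqP->//|]; apply: aP.
    have [ask|Na] := pselect (lt a (s k.+1)).
      exists (s k.+1); split=> // n; rewrite leq_eqVlt => /orP[/eqP-> _|nk nd]; first exact: lt_irr.
      by move=> /(lt_tr ask); apply: aP.
    by exists a; split=> // n; rewrite leq_eqVlt => /orP[/eqP->//|]; apply: aP.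
have [C [[Cg Ccof Cclos] CS]] : exists C, club lt (fun b => lt b g) C /\ forall c, C c -> ~ S c.
  apply: contrapT => N; apply: (HSnr glim gcof) => C CC; apply: contrapT => NC.
  apply: N; exists C; split=> // c Cc Sc; apply: NC; exists c; split=> //; split=> //.
  by case: CC => + _ _; apply.
apply: (disjoint_tails_glue (C := C)) => // d Sd dg; apply: contrapT => N.
apply: (CS d) => //; apply: Cclos => //; first exact: S_limit.
move=> a ad; apply: contrapT => Na; apply: N; exists a; split=> // c Cc cd ac.
by apply: Na; exists c.
Qed.

Lemma exists_disjoint_tails_above g a : exists h, disjoint_tails g h /\
  forall d n, S d -> lt a d -> (h d <= n)%N -> lt a (eta d n).
Proof.
have [h hP] := exists_disjoint_tails g.
have /choice [k kP] : forall d, exists k, S d -> lt a d -> forall n, (k <= n)%N -> lt a (eta d n).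
  move=> d; have [[Sd ad]|N] := pselect (S d /\ lt a d); last by exists 0%N => *; case: N.
  by have [k kP] := ladder_eventually (etaP Sd) ad; exists k.
exists (fun d => maxn (h d) (k d)); split.
  move=> d d' m n Sd Sd' dg d'g; rewrite !geq_max => /andP[hm _] /andP[hn _].
  exact: hP.
by move=> d n Sd ad; rewrite geq_max => /andP[_]; apply: kP.
Qed.

End Ladders.

Section Pairing.
Variables (O : Type) (lt : O -> O -> Prop).
Hypothesis Hwo : well_order lt.
Hypothesis Hreg : regular_uncountable_cardinal lt.
Variable (g : O -> O -> Prop) (S : O -> Prop).
Hypothesis gS : forall a b, S a -> g a b -> lt b a.
Hypothesis gP : forall X : O -> Prop, stationary lt (fun=> True)
        (fun a => S a /\ forall b, lt b a -> (X b <-> g a b)).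

(* A diamond sequence enumerates all bounded subsets, in particular all Kuratowski pairs. *)
Lemma exists_pairing : exists pr : O -> O -> O,
  forall x y x' y', pr x y = pr x' y' -> x = x' /\ y = y'.
Proof.
have /choice [c cP] : forall X : O -> Prop, exists a,
    (exists b, forall x, X x -> lt x b) -> forall x, X x <-> g a x.
  move=> X; have [[b bX]|N] := pselect (exists b, forall x, X x -> lt x b); last first.
    have [a _] := gP X (club_True Hwo Hreg); by exists a.
  have [a [[Sa aP] ba]] := gP X (club_above Hwo Hreg b).
  exists a => _ x; split=> [Xx|gx]; last by apply/aP => //; apply: gS gx.
  by apply/aP => //; apply: (lt_tr Hwo) ba; apply: bX.
pose code x y := c (fun z => z = x \/ z = y).
have codeP x y z : g (code x y) z <-> z = x \/ z = y.
  rewrite -(cP (fun z => z = x \/ z = y)) //.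
  by have [b [xb yb]] := ord_max2 Hwo Hreg x y; exists b => ? [] ->.
have code_inj x y x' y' : code x y = code x' y' -> (x = x' /\ y = y') \/ (x = y' /\ y = x').
  move=> E.
  have /codeP Hx : g (code x' y') x by rewrite -E; apply/codeP; left.
  have /codeP Hy : g (code x' y') y by rewrite -E; apply/codeP; right.
  have /codeP Hx' : g (code x y) x' by rewrite E; apply/codeP; left.
  have /codeP Hy' : g (code x y) y' by rewrite E; apply/codeP; right.
  by case: Hx Hy Hx' Hy' => [?|?] [?|?] [?|?] [?|?];
     first [left; split; congruence | right; split; congruence].
exists (fun x y => code (code x x) (code x y)) => x y x' y' /code_inj [].
  move=> [/code_inj E1 /code_inj E2].
  by case: E1 E2 => -[E1 E2] [] [E3 E4]; split; congruence.
move=> [/code_inj E1 /code_inj E2].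
by case: E1 E2 => -[E1 E2] [] [E3 E4]; split; congruence.
Qed.

End Pairing.

(** * Quotients and free subgroups *)

Record sub_congruence := SubCongruence {
  sc_sort : Type;
  sc_zero : sc_sort;
  sc_sub : sc_sort -> sc_sort -> sc_sort;
  sc_rel : sc_sort -> sc_sort -> Prop;
  sc_refl : forall x, sc_rel x x;
  sc_sym : forall x y, sc_rel x y -> sc_rel y x;
  sc_trans : forall x y z, sc_rel x y -> sc_rel y z -> sc_rel x z;
  sc_congr : forall x x' y y', sc_rel x x' -> sc_rel y y' -> sc_rel (sc_sub x y) (sc_sub x' y');
  sc_subx0 : forall x, sc_rel (sc_sub x sc_zero) x;
  sc_subxx : forall x, sc_rel (sc_sub x x) sc_zero;
  sc_subACA : forall x y z w,
    sc_rel (sc_sub (sc_sub x y) (sc_sub z w)) (sc_sub (sc_sub x z) (sc_sub y w)) }.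

Definition quot (D : sub_congruence) := {P : sc_sort D -> Prop | exists x, P = sc_rel x}.

Definition class (D : sub_congruence) (x : sc_sort D) : quot D :=
  exist _ (sc_rel x) (ex_intro _ x erefl).

Section Quotient.
Variable D : sub_congruence.
Implicit Types x y z : quot D.

Lemma classP (a b : sc_sort D) : class a = class b <-> sc_rel a b.
Proof.
split=> [/(congr1 sval) /= ->|ab]; first exact: sc_refl.
apply: sval_injective => /=; apply/funext => c; apply/propext; split.
  exact: sc_trans (sc_sym ab).
exact: sc_trans ab.
Qed.

Lemma class_surj x : exists a, class a = x.
Proof. by case: x => P [a Pa]; exists a; apply: sval_injective. Qed.

Let repr x := projT1 (cid (class_surj x)).
Let reprK x : class (repr x) = x. Proof. by rewrite /repr; case: cid. Qed.
Let qsub x y := class (sc_sub (repr x) (repr y)).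

Let qsubE a b : qsub (class a) (class b) = class (sc_sub a b).
Proof. by apply/classP/sc_congr; apply/classP; rewrite reprK. Qed.

Let q0 := class (sc_zero D).
Let qsubx0 x : qsub x q0 = x.
Proof. have [a <-] := class_surj x; rewrite qsubE; exact/classP/sc_subx0. Qed.
Let qsubxx x : qsub x x = q0.
Proof. have [a <-] := class_surj x; rewrite qsubE; exact/classP/sc_subxx. Qed.
Let qsubACA x y z w : qsub (qsub x y) (qsub z w) = qsub (qsub x z) (qsub y w).
Proof.
have [a <-] := class_surj x; have [b <-] := class_surj y.
have [c <-] := class_surj z; have [d <-] := class_surj w.
rewrite !qsubE; exact/classP/sc_subACA.
Qed.
Let qopp x := qsub q0 x.
Let qadd x y := qsub x (qopp y).

Let qoppK x : qopp (qopp x) = x.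
Proof. by rewrite /qopp -{1}(qsubxx x) qsubACA qsubx0 qsubxx qsubx0. Qed.
Let qaddC : commutative qadd.
Proof.
have sw x y : qsub (qopp x) y = qsub (qopp y) x.
  by rewrite -{1}(qsubx0 y) qsubACA qsubx0.
move=> x y; rewrite /qadd -{1}(qoppK x) -{1}(qoppK y) {1}/qopp {2}/qopp.
by rewrite qsubACA sw -qsubACA -/(qopp _) -/(qopp _) !qoppK.
Qed.
Let qaddA : associative qadd.
Proof.
move=> x y z; rewrite /qadd.
have -> : qopp (qsub y (qopp z)) = qsub (qopp y) z.
  by rewrite /qopp -{1}(qsubxx q0) qsubACA -/(qopp _) -/(qopp (qopp z)) qoppK.
by rewrite -{1}(qsubx0 x) qsubACA.
Qed.
Let qadd0 : left_id q0 qadd. Proof. exact: qoppK. Qed.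
Let qaddN : left_inverse q0 qopp qadd. Proof. by move=> x; apply: qsubxx. Qed.

HB.instance Definition _ := gen_eqMixin (quot D).
HB.instance Definition _ := gen_choiceMixin (quot D).
HB.instance Definition _ := GRing.isZmodule.Build (quot D) qaddA qaddC qadd0 qaddN.

Lemma class_sub a b : class (sc_sub a b) = class a - class b.
Proof. by rewrite -qsubE -[RHS]/(qsub (class a) (qopp (qopp (class b)))) qoppK. Qed.

Lemma class_zero : class (sc_zero D) = 0. Proof. by []. Qed.

End Quotient.

Section HomCongruence.
Variables (X : Type) (z : X) (sub : X -> X -> X) (F : forall W : zmodType, (X -> W) -> Prop).
Hypothesis Fz : forall W f, F (W := W) f -> f z = 0.
Hypothesis Fsub : forall W f, F (W := W) f -> forall x y, f (sub x y) = f x - f y.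

Definition hom_rel x y := forall W f, F (W := W) f -> f x = f y.

Let hom_refl x : hom_rel x x. Proof. by []. Qed.
Let hom_sym x y : hom_rel x y -> hom_rel y x.
Proof. by move=> xy W f Ff; rewrite (xy W f). Qed.
Let hom_trans x y t : hom_rel x y -> hom_rel y t -> hom_rel x t.
Proof. by move=> xy yt W f Ff; rewrite (xy W f) // (yt W f). Qed.
Let hom_congr x x' y y' : hom_rel x x' -> hom_rel y y' -> hom_rel (sub x y) (sub x' y').
Proof. by move=> xx yy W f Ff; rewrite !(Fsub Ff) (xx W f) // (yy W f). Qed.
Let hom_subx0 x : hom_rel (sub x z) x.
Proof. by move=> W f Ff; rewrite (Fsub Ff) (Fz Ff) subr0. Qed.
Let hom_subxx x : hom_rel (sub x x) z.
Proof. by move=> W f Ff; rewrite (Fsub Ff) (Fz Ff) subrr. Qed.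
Let hom_subACA x y t w : hom_rel (sub (sub x y) (sub t w)) (sub (sub x t) (sub y w)).
Proof. by move=> W f Ff; rewrite !(Fsub Ff) !opprB ![f w + _]addrC addrACA. Qed.

(* The group presented by the requirement that all maps in [F] factor through it. *)
Definition hom_congruence : sub_congruence :=
  SubCongruence hom_refl hom_sym hom_trans hom_congr hom_subx0 hom_subxx hom_subACA.

Lemma hom_classP x y : @class hom_congruence x = @class hom_congruence y <-> hom_rel x y.
Proof. exact: (@classP hom_congruence). Qed.

Lemma hom_congruence_lift (W : zmodType) (f : X -> W) : F f ->
  exists g : quot hom_congruence -> W, additive_fun g /\
    forall x, g (@class hom_congruence x) = f x.
Proof.
move=> Ff; have /choice [r rK] := @class_surj hom_congruence.
have fr x : f (r (@class hom_congruence x)) = f x.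
  by have /hom_classP/(_ W f Ff) := rK (@class hom_congruence x).
exists (f \o r); split=> // x y /=.
by rewrite -(Fsub Ff) -{1}(rK x) -{1}(rK y) -class_sub fr.
Qed.

End HomCongruence.

Section Additive.
Variables (U V : zmodType) (f : U -> V).
Hypothesis fA : additive_fun f.

Lemma additive_fun0 : f 0 = 0.
Proof. by rewrite -(subrr 0) fA subrr. Qed.

Lemma additive_funN x : f (- x) = - f x.
Proof. by rewrite -[- x]sub0r fA additive_fun0 sub0r. Qed.

Lemma additive_funD x y : f (x + y) = f x + f y.
Proof. by rewrite -{1}[y]opprK fA additive_funN opprK. Qed.

Lemma additive_fun_sum (I : Type) (s : seq I) (F : I -> U) :
  f (\sum_(i <- s) F i) = \sum_(i <- s) f (F i).
Proof. by elim/big_rec2: _ => [|i y x _ <-]; rewrite ?additive_fun0 ?additive_funD. Qed.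

Lemma additive_funMz x n : f (x *~ n) = f x *~ n.
Proof.
have nat_case k : f (x *+ k) = f x *+ k.
  by elim: k => [|k IH]; rewrite ?additive_fun0 // !mulrS additive_funD IH.
by case: n => k; rewrite ?NegzE ?mulrNz ?additive_funN -!pmulrn nat_case.
Qed.

End Additive.

Section Subgroups.
Variables (V : zmodType) (H : V -> Prop).
Hypothesis HH : subgroup H.

Lemma subgroup0 : H 0. Proof. by case: HH. Qed.
Lemma subgroupD x y : H x -> H y -> H (x + y). Proof. by case: HH => _ + _; apply. Qed.
Lemma subgroupN x : H x -> H (- x). Proof. by case: HH => _ _; apply. Qed.
Lemma subgroupB x y : H x -> H y -> H (x - y).
Proof. by move=> Hx Hy; apply: subgroupD => //; apply: subgroupN. Qed.
Lemma subgroupMz x n : H x -> H (x *~ n).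
Proof.
move=> Hx; have nat_case k : H (x *+ k).
  by elim: k => [|k IH]; [apply: subgroup0|rewrite mulrS; apply: subgroupD].
by case: n => k; rewrite ?NegzE ?mulrNz -?pmulrn //; apply: subgroupN.
Qed.
Lemma subgroup_sum (I : eqType) (s : seq I) (F : I -> V) :
  (forall i, i \in s -> H (F i)) -> H (\sum_(i <- s) F i).
Proof.
move=> HF; rewrite big_seq; apply: big_ind => //; first exact: subgroup0.
exact: subgroupD.
Qed.

End Subgroups.

Section SubgroupQuotient.
Variables (V : zmodType) (H : V -> Prop).
Hypothesis HH : subgroup H.

Let coset_refl x : H (x - x). Proof. by rewrite subrr; apply: subgroup0. Qed.
Let coset_sym x y : H (x - y) -> H (y - x).
Proof. by move=> /(subgroupN HH); rewrite opprB. Qed.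
Let coset_trans x y z : H (x - y) -> H (y - z) -> H (x - z).
Proof. by move=> xy yz; rewrite -(subrK y x) -addrA; apply: (subgroupD HH). Qed.
Let coset_congr x x' y y' : H (x - x') -> H (y - y') -> H (x - y - (x' - y')).
Proof.
move=> xx /(subgroupN HH) yy; have := subgroupD HH xx yy.
by rewrite !opprB [y' - x']addrC [x - y + _]addrACA [- y + y']addrC.
Qed.
Let coset_subx0 x : H (x - 0 - x). Proof. by rewrite subr0 subrr; apply: subgroup0. Qed.
Let coset_subxx x : H (x - x - 0). Proof. by rewrite subrr subr0; apply: subgroup0. Qed.
Let coset_subACA x y z w : H (x - y - (z - w) - (x - z - (y - w))).
Proof.
suff -> : x - y - (z - w) = x - z - (y - w) by rewrite subrr; apply: subgroup0.
by rewrite !opprB ![w + _]addrC addrACA.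
Qed.

Definition subgroup_congruence : sub_congruence :=
  @SubCongruence V 0 (fun x y => x - y) (fun x y => H (x - y)) coset_refl coset_sym
    coset_trans coset_congr coset_subx0 coset_subxx coset_subACA.

Lemma cosetP x y : @class subgroup_congruence x = @class subgroup_congruence y <-> H (x - y).
Proof. exact: (@classP subgroup_congruence). Qed.

End SubgroupQuotient.

Section Spans.
Variable V : zmodType.
Implicit Types (B H : V -> Prop) (x y : V) (s t : seq V) (f : V -> int).

(* [f] vanishes outside [s], so that representations by different [s] are comparable *)
Definition repr_by B x f := exists s, [/\ uniq s, forall a, a \in s -> B a,
  forall a, a \notin s -> f a = 0 & x = \sum_(a <- s) a *~ f a].

Definition zspan B x := exists f, repr_by B x f.

Lemma sum_support s t f : uniq s -> uniq t -> {subset s <= t} ->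
  (forall a, a \notin s -> f a = 0) -> \sum_(a <- t) a *~ f a = \sum_(a <- s) a *~ f a.
Proof.
move=> us ut st f0; rewrite (bigID (mem s)) /= [X in _ + X]big1 ?addr0; last first.
  by move=> a /f0 ->; rewrite mulr0z.
rewrite -big_filter; apply: perm_big; apply: uniq_perm; rewrite ?filter_uniq // => a.
by rewrite mem_filter; case: (boolP (a \in s)) => // /st.
Qed.

Lemma repr_by_sub B x y f g :
  repr_by B x f -> repr_by B y g -> repr_by B (x - y) (fun a => f a - g a).
Proof.
move=> [s [us sB f0 ->]] [t [ut tB g0 ->]]; exists (undup (s ++ t)); split.
- exact: undup_uniq.
- by move=> a; rewrite mem_undup mem_cat => /orP[/sB|/tB].
- by move=> a; rewrite mem_undup mem_cat negb_or => /andP[/f0-> /g0->]; rewrite subr0.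
rewrite -(@sum_support s (undup (s ++ t)) f) ?undup_uniq //; last first.
  by move=> a; rewrite mem_undup mem_cat => ->.
rewrite -(@sum_support t (undup (s ++ t)) g) ?undup_uniq //; last first.
  by move=> a; rewrite mem_undup mem_cat => ->; rewrite orbT.
by rewrite -sumrB; apply: eq_bigr => a _; rewrite mulrzBr.
Qed.

Lemma repr_by0 B : repr_by B 0 (fun=> 0).
Proof. by exists [::]; split=> //; rewrite big_nil. Qed.

Lemma zspan_subgroup B : subgroup (zspan B).
Proof.
have zspanB x y : zspan B x -> zspan B y -> zspan B (x - y).
  by move=> [f xf] [g yg]; exists (fun a => f a - g a); apply: repr_by_sub.
have span0 : zspan B 0 by exists (fun=> 0); apply: repr_by0.
have spanN x : zspan B x -> zspan B (- x) by rewrite -[- x]sub0r => /(zspanB 0); apply.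
by split=> // x y Bx /spanN By; rewrite -[y]opprK; apply: zspanB.
Qed.

Lemma zspan_gen B x : B x -> zspan B x.
Proof.
move=> Bx; exists (fun a => (a == x)%:R); exists [:: x]; split=> //.
- by move=> a; rewrite inE => /eqP->.
- by move=> a; rewrite inE => /negPf->.
- by rewrite big_seq1 eqxx.
Qed.

Lemma zspan_min B H x : subgroup H -> (forall b, B b -> H b) -> zspan B x -> H x.
Proof.
move=> HH BH [f [s [_ sB _ ->]]]; apply: (subgroup_sum HH) => a /sB/BH.
exact: subgroupMz.
Qed.

Definition independent B := forall f, repr_by B 0 f -> forall a, f a = 0.

Lemma repr_by_uniq B x f g : independent B -> repr_by B x f -> repr_by B x g -> f =1 g.
Proof.
move=> iB xf xg a; have := repr_by_sub xf xg; rewrite subrr => /iB/(_ a)/eqP.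
by rewrite subr_eq0 => /eqP.
Qed.

Lemma free_basisP H B : free_basis H B <->
  [/\ forall b, B b -> H b, forall x, H x -> zspan B x & independent B].
Proof.
split=> [[BH HB iB]|[BH HB iB]]; split=> //.
- move=> x /HB [s [c [sB ->]]]; apply: (subgroup_sum (zspan_subgroup B)) => a /sB Ba.
  exact: (subgroupMz (zspan_subgroup B)) (zspan_gen Ba).
- move=> f [s [us sB f0 /esym E]] a; have [as_|/f0//] := boolP (a \in s).
  exact: iB us sB E a as_.
- by move=> x /HB [f [s [_ sB _ ->]]]; exists s, f.
- move=> s c us sB E a as_; pose f a := if a \in s then c a else 0.
  have : repr_by B 0 f.
    exists s; split=> //; first by move=> b; rewrite /f => /negPf->.
    by rewrite -[LHS]E; apply: eq_big_seq => b bs; rewrite /f bs.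
  by move=> /iB/(_ a); rewrite /f as_.
Qed.

Lemma repr_by_additive B (W : zmodType) (F : V -> W) x f : additive_fun F -> repr_by B x f ->
  exists s, [/\ uniq s, forall a, a \in s -> B a, forall a, a \notin s -> f a = 0 &
    F x = \sum_(a <- s) F a *~ f a].
Proof.
move=> FA [s [us sB f0 ->]]; exists s; split=> //; rewrite additive_fun_sum //.
by apply: eq_bigr => a _; rewrite additive_funMz.
Qed.

Lemma dual_coordinate B (F : V -> rat) b x f : additive_fun F -> B b ->
  (forall a, B a -> F a = (a == b)%:R) -> repr_by B x f -> F x = (f b)%:~R.
Proof.
move=> FA Bb FB /(repr_by_additive FA) [s [us sB f0 ->]].
rewrite (eq_big_seq (fun a => if a == b then (f b)%:~R else 0)); last first.
  by move=> a /sB/FB ->; case: eqP => [->|_]; rewrite ?mul0rz.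
rewrite -big_mkcond /=; have [bs|bs] := boolP (b \in s).
  by rewrite -big_filter (filter_pred1_uniq us bs) big_seq1.
by rewrite f0 // big_seq_cond big1 // => a /andP[+ /eqP->]; rewrite (negPf bs).
Qed.

Lemma dual_independent B (F : V -> V -> rat) : (forall b, B b -> additive_fun (F b)) ->
  (forall b a, B b -> B a -> F b a = (a == b)%:R) -> independent B.
Proof.
move=> FA FB f f0 a; have [Ba|NBa] := pselect (B a).
  have := dual_coordinate (FA a Ba) Ba (fun c => FB a c Ba) f0.
  by rewrite (additive_fun0 (FA a Ba)) => /esym/eqP; rewrite intr_eq0 => /eqP.
by have [s [_ sB -> //]] := f0; apply/negP => /sB.
Qed.

End Spans.

Lemma exists_well_order (T : Type) : exists lt : T -> T -> Prop, well_order lt.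
Proof.
pose T' := [the eqType of {classic T}].
have [R Rwo] := wochoice.well_ordering_principle T'.
have Rmin (A : T' -> Prop) : (exists x, A x) -> exists x, A x /\ forall y, A y -> R x y.
  move=> [x Ax]; have /Rwo [z [[Az zmin] _]] : wochoice.nonempty (fun x => `[<A x>]).
    by exists x; apply/asboolP.
  by exists z; split; [apply/asboolP|move=> y Ay; apply: zmin; apply/asboolP].
have Rtot : total R.
  move=> x y; have [z [[->|->] zmin]] :=
    Rmin (fun z => z = x \/ z = y) (ex_intro _ x (or_introl erefl)).
    by rewrite zmin //; right.
  by rewrite zmin ?orbT //; left.
have Ranti x y : R x y -> R y x -> x = y.
  move=> xy yx; have [|z [_ zu]] := Rwo (pred2 x y); first by exists x; apply/orP; left.
  have Rxx u : R u u by have := Rtot u u; rewrite orbb.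
  have -> : x = z.
    by apply/esym/zu; split=> [|u /orP[/eqP->|/eqP->]] //; apply/orP; left.
  by apply: zu; split=> [|u /orP[/eqP->|/eqP->]] //; apply/orP; right.
exists (fun x y : T' => R x y /\ x <> y); split.
- by move=> a [].
- have trans : transitive R.
    move=> y x z xy yz; have [u [uxyz umin]] :=
      Rmin (fun u => [\/ u = x, u = y | u = z]) (ex_intro _ x (Or31 _ _ erefl)).
    case: uxyz umin => -> umin; first by apply: umin; apply: Or33.
      by rewrite (Ranti x y xy (umin x (Or31 _ _ erefl))).
    have zy : z = y by apply: Ranti => //; apply: umin; apply: Or32.
    by rewrite zy.
  move=> a b c [ab nab] [bc nbc]; split; first exact: trans ab bc.
  by move=> ac; apply: nbc; apply: Ranti => //; rewrite -ac.
- move=> a b; have [->|ab] := pselect (a = b); first by right; left.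
  by have /orP[?|?] := Rtot a b; [left|right; right; split=> // /esym].
- move=> x; apply: contrapT => Nx.
  have [z [Nz zmin]] := Rmin (fun x => ~ Acc (fun x y => R x y /\ x <> y) x) (ex_intro _ x Nx).
  apply: Nz; constructor => y [yz nyz]; apply: contrapT => /zmin zy.
  by apply: nyz; apply: Ranti.
Qed.

Section FreeSubgroup.
Variables (V : zmodType) (F B H : V -> Prop).
Hypothesis FB : free_basis F B.
Hypothesis HH : subgroup H.
Hypothesis HF : forall x, H x -> F x.

Variable lt : V -> V -> Prop.
Hypothesis Hwo : well_order lt.

Let cf x : V -> int := if pselect (exists f, repr_by B x f) is left e then projT1 (cid e)
  else fun=> 0.

Let cfP x : F x -> repr_by B x (cf x).
Proof.
have [_ FB' _] := (free_basisP _ _).1 FB; move=> /FB' Fx.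
by rewrite /cf; case: pselect => // e; case: cid.
Qed.

Let cfE x f : F x -> repr_by B x f -> cf x =1 f.
Proof. by have [_ _ iB] := (free_basisP _ _).1 FB => /cfP; apply: repr_by_uniq. Qed.

Let cfB x y : H x -> H y -> forall b, cf (x - y) b = cf x b - cf y b.
Proof.
move=> Hx Hy; apply: cfE; first exact/HF/(subgroupB HH).
by apply: repr_by_sub; apply/cfP/HF.
Qed.

Let cf0 b : cf 0 b = 0.
Proof. by rewrite -[0](subrr 0) cfB ?subrr //; apply: subgroup0 HH. Qed.

Let cfN x : H x -> forall b, cf (- x) b = - cf x b.
Proof. by move=> Hx b; rewrite -[- x]sub0r cfB ?cf0 ?sub0r //; apply: subgroup0 HH. Qed.

Let cfD x y : H x -> H y -> forall b, cf (x + y) b = cf x b + cf y b.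
Proof.
by move=> Hx Hy b; rewrite -{1}[y]opprK cfB ?cfN ?opprK //; exact: (subgroupN HH).
Qed.

Let cfMz x n : H x -> forall b, cf (x *~ n) b = cf x b * n.
Proof.
move=> Hx b; have nat_case k : cf (x *+ k) b = cf x b * k%:Z.
  elim: k => [|k IH]; first by rewrite cf0 mulr0.
  by rewrite mulrS cfD ?IH ?intS ?mulrDr ?mulr1 // pmulrn; apply: (subgroupMz HH).
case: n => k; rewrite ?NegzE -?pmulrn ?nat_case // mulrNz cfN ?nat_case ?mulrN //.
exact: (subgroupMz HH k.+1%:Z Hx).
Qed.

Let cf_sum (s : seq V) (c : V -> int) b : (forall y, y \in s -> H y) ->
  cf (\sum_(y <- s) y *~ c y) b = \sum_(y <- s) cf y b * c y.
Proof.
elim: s => [|y s IH] sH; first by rewrite !big_nil cf0.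
have Hy : H y by apply: sH; rewrite mem_head.
have sH' z : z \in s -> H z by move=> zs; apply: sH; rewrite inE zs orbT.
rewrite !big_cons cfD ?IH ?cfMz //; first exact: (subgroupMz HH).
by apply: (subgroup_sum HH) => z /sH'; apply: (subgroupMz HH).
Qed.

Let below x b := forall a, cf x a <> 0 -> a = b \/ lt a b.

Let lead b n := exists x, [/\ H x, below x b & cf x b = n%:Z].

(* [cf y b] generates the ideal of the leading coefficients at [b]. *)
Let generator b y := [/\ H y, below y b, 0 < cf y b &
  forall x, H x -> below x b -> exists q, cf x b = cf y b * q].

Let below_sub x y b : H x -> H y -> below x b -> below y b -> below (x - y) b.
Proof.
move=> Hx Hy xb yb a; rewrite cfB // => N.
have [E|] := pselect (cf x a = 0); last exact: xb.
by apply: yb => E'; apply: N; rewrite E E' subr0.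
Qed.

Let below_Mz x n b : H x -> below x b -> below (x *~ n) b.
Proof.
by move=> Hx xb a; rewrite cfMz // => N; apply: xb => E; apply: N; rewrite E mul0r.
Qed.

Let exists_generator b : (exists y, generator b y) \/
  forall x, H x -> below x b -> cf x b = 0.
Proof.
have [[n npos]|N] := pselect (exists n, lead b n.+1); last first.
  right=> x Hx xb; case E: (cf x b) => [[|n]|n] //; case: N; exists n.
    by exists x.
  exists (- x); split; [exact: (subgroupN HH Hx)| |by rewrite cfN // E NegzE opprK].
  have below0 : below 0 b by move=> a; rewrite cf0.
  by rewrite -sub0r; apply: (below_sub (subgroup0 HH)).
have ex : exists n, `[<lead b n.+1>] by exists n; apply/asboolP.
left; have := ex_minnP ex; case=> {npos}n /asboolP [y [Hy yb yE]] ymin.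
exists y; split; rewrite ?yE // => x Hx xb; exists (cf x b %/ n.+1%:Z)%Z.
have d0 : n.+1%:Z != 0 by [].
have := divz_eq (cf x b) n.+1%:Z; set q := (_ %/ _)%Z; set r := (_ %% _)%Z => E.
have r0 : 0 <= r by apply: modz_ge0.
have rd : r < n.+1%:Z by have := ltz_mod (cf x b) d0.
suff r00 : r = 0 by rewrite {1}E r00 addr0 mulrC.
case: (r) r0 rd E => [[|m]|m] // _ md E.
have : lead b m.+1.
  have Hq := subgroupMz HH q Hy.
  exists (x - y *~ q); split; first exact: (subgroupB HH).
    by apply: below_sub => //; apply: below_Mz.
  by rewrite cfB // cfMz // yE E; ring.
by move=> /asboolP/ymin; lia.
Qed.

Let seq_max (s : seq V) : s <> [::] -> exists a, a \in s /\ forall b, b \in s -> b = a \/ lt b a.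
Proof.
elim: s => // a s IH _; have [->|/IH [m [ms mmax]]] := pselect (s = [::]).
  by exists a; split; [rewrite mem_head|move=> b; rewrite inE => /eqP; left].
have [am|[am|ma]] := lt_tot Hwo a m.
- exists m; split; first by rewrite inE ms orbT.
  by move=> b; rewrite inE => /orP[/eqP->|/mmax//]; right.
- exists m; split; first by rewrite inE ms orbT.
  by move=> b; rewrite inE => /orP[/eqP->|/mmax//]; left.
exists a; split; [exact: mem_head|move=> b; rewrite inE => /orP[/eqP->|]; first by left].
by move=> /mmax [->|bm]; right => //; exact: (lt_tr Hwo bm ma).
Qed.

Let exists_max_support x : H x -> x = 0 \/ exists b, cf x b <> 0 /\ below x b.
Proof.
move=> /HF/cfP [s [us sB f0 xE]].
pose t := [seq a <- s | cf x a != 0].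
have [t0|/seq_max[b [bt bmax]]] := pselect (t = [::]); [left|right].
  rewrite xE big_seq big1 // => a as_; have : a \notin t by rewrite t0.
  by rewrite mem_filter as_ andbT negbK => /eqP->; rewrite mulr0z.
have tP a : (a \in t) <-> cf x a <> 0.
  rewrite mem_filter; split=> [/andP[/eqP//]|/eqP N]; rewrite N /=.
  by apply: contraNT N => /f0->.
by exists b; split; [apply/tP|move=> a /tP/bmax].
Qed.

Lemma free_subgroup_of_well_order : free_subgroup H.
Proof.
have /choice [h hP] : forall b, exists y, (exists z, generator b z) -> generator b y.
  by move=> b; have [[y yP]|N] := pselect (exists y, generator b y); [exists y|exists 0].
pose B' y := exists b, generator b (h b) /\ y = h b.
have B'H y : B' y -> H y by move=> [b [[Hb _ _ _] ->]].
exists B'; apply/free_basisP; split=> // [x Hx|f].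
  suff IH b : forall x, H x -> below x b -> zspan B' x.
    have [->|[b [_ xb]]] := exists_max_support Hx; last exact: IH xb.
    exact: subgroup0 (zspan_subgroup B').
  elim/(well_founded_ind (lt_wf Hwo)): b {x Hx} => b IH x Hx xb.
  have low y : H y -> below y b -> cf y b = 0 -> zspan B' y.
    move=> Hy yb y0; have [->|[a [ya ymax]]] := exists_max_support Hy.
      exact: subgroup0 (zspan_subgroup B').
    by have [ab|ab] := yb a ya; [rewrite ab y0 in ya|apply: (IH a)].
  have [gb|/(_ x Hx xb)] := exists_generator b; last exact: low.
  have gh := hP b gb; have [Hh hb hpos /(_ x Hx xb) [q qE]] := gh.
  have Hq := subgroupMz HH q Hh.
  rewrite -[x](subrK (h b *~ q)); apply: (subgroupD (zspan_subgroup B')).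
    apply: low; first exact: (subgroupB HH).
      by apply: below_sub => //; apply: below_Mz.
    by rewrite cfB // cfMz // qE subrr.
  by apply: (subgroupMz (zspan_subgroup B')); apply: zspan_gen; exists b.
move=> [s [us sB' f0 sE]] a; have [as_|/f0//] := boolP (a \in s).
have /choice [be beP] : forall y, exists b, B' y -> generator b y /\ y = h b.
  move=> y; have [[b [gb yb]]|N] := pselect (B' y); last by exists 0.
  by exists b => _; rewrite {1}yb.
apply: contrapT => Na; pose t := [seq be y | y <- s & f y != 0].
have [E|/seq_max [b [bt bmax]]] := pselect (t = [::]).
  have : be a \in t by apply: map_f; rewrite mem_filter as_ andbT; apply/eqP.
  by rewrite E.
have /mapP [y0] := bt; rewrite mem_filter => /andP[fy0 y0s] bE.
have [[Hy0 _ ypos _] y0E] := beP _ (sB' _ y0s).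
have : cf 0 b = 0 by apply: cf0.
rewrite {1}sE cf_sum; last by move=> y /sB'/B'H.
rewrite (bigD1_seq y0) //= big_seq_cond big1 ?addr0 => [|y /andP[ys yy0]].
  by move=> /eqP; rewrite mulf_eq0 (negPf fy0) orbF bE => /eqP E; rewrite E ltxx in ypos.
have [fy|fy] := eqVneq (f y) 0; first by rewrite fy mulr0.
have [[Hy ybel _ _] yE] := beP _ (sB' _ ys).
have bey : be y = b \/ lt (be y) b.
  by apply: bmax; apply: map_f; rewrite mem_filter fy.
have [->|/ybel] := pselect (cf y b = 0); first by rewrite mul0r.
case: bey => [E|bb [E|bb']].
- by case/eqP: yy0; rewrite yE y0E E bE.
- by move: bb; rewrite E => /(lt_irr Hwo).
- by case: (ord_lt_asym Hwo bb bb').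
Qed.

End FreeSubgroup.

Lemma subgroup_of_free (V : zmodType) (F H : V -> Prop) :
  free_subgroup F -> subgroup H -> (forall x, H x -> F x) -> free_subgroup H.
Proof.
move=> [B FB] HH HF; have [lt Hwo] := exists_well_order V.
exact: free_subgroup_of_well_order FB HH HF lt Hwo.
Qed.

(** * Groups closed under solutions of recursions *)

(* Each pair [(A, a)] poses one instance of the recursion
   [2 v(d, n+1) = v(d, n) + u(eta d n) + a(d, n)], and [Ut A a], [Vt A a] name a generic
   solution [u], [v] of it. Since [a] consists of terms again, a group of such terms solves
   all instances posed by its own elements. *)
Inductive term (O : Type) : Type :=
| Zr : term O
| Sb : term O -> term O -> term O
| Gen : (O -> bool) -> term O
| Ut : (O -> bool) -> (O -> nat -> term O) -> O -> term O
| Vt : (O -> bool) -> (O -> nat -> term O) -> O -> nat -> term O.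
Arguments Zr {O}.

Section TermGroup.
Variables (O : Type) (eta : O -> nat -> O).
Variable Rl : (O -> bool) -> (O -> nat -> term O) -> O -> Prop.

Definition valuation (W : zmodType) (f : term O -> W) :=
  [/\ f Zr = 0, forall t s, f (Sb t s) = f t - f s &
    forall A a d, Rl A a d -> forall n,
      f (Vt A a d n.+1) *+ 2 = f (Vt A a d n) + f (Ut A a (eta d n)) + f (a d n)].

Lemma valuation_zero (W : zmodType) (f : term O -> W) : valuation f -> f Zr = 0.
Proof. by case. Qed.

Lemma valuation_sub (W : zmodType) (f : term O -> W) :
  valuation f -> forall t s, f (Sb t s) = f t - f s.
Proof. by case. Qed.

Definition term_congruence := hom_congruence valuation_zero valuation_sub.
Definition term_group : zmodType := quot term_congruence.
Definition cl (t : term O) : term_group := @class term_congruence t.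

Lemma cl_surj x : exists t, cl t = x.
Proof. exact: (@class_surj term_congruence). Qed.

Lemma cl_sub t s : cl (Sb t s) = cl t - cl s.
Proof. exact: (@class_sub term_congruence). Qed.

Lemma clP t s : cl t = cl s <->
  forall (W : zmodType) (f : term O -> W), valuation f -> f t = f s.
Proof. exact: hom_classP. Qed.

Lemma cl_zero : cl Zr = 0. Proof. by []. Qed.

Lemma cl_valuation : valuation cl.
Proof.
split=> // [t s|A a d Rd n]; first exact: cl_sub.
have ad t s : cl t + cl s = cl (Sb t (Sb Zr s)).
  by rewrite !cl_sub cl_zero sub0r opprK.
rewrite mulr2n !ad; apply/clP => W f fv; have [f0 fB fR] := fv.
by rewrite !fB f0 !sub0r !opprK -fR // mulr2n.
Qed.

Lemma valuation_lift (W : zmodType) (f : term O -> W) : valuation f ->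
  exists g : term_group -> W, additive_fun g /\ forall t, g (cl t) = f t.
Proof. exact: hom_congruence_lift. Qed.

End TermGroup.

Arguments cl {O eta Rl} t.

Lemma rat_recursion (b : nat -> rat) m z :
  exists f : nat -> rat, f m = z /\ forall n, f n.+1 *+ 2 = f n + b n.
Proof.
elim: m z => [|m IH] z.
  pose f := fix f n := if n is n'.+1 then (f n' + b n') / 2 else z.
  by exists f; split=> // n /=; rewrite -mulr_natr; field.
have [f [fm fR]] := IH (z *+ 2 - b m); exists f; split=> //.
by have := fR m; rewrite fm; lra.
Qed.

Section Basis.
Variables (O : Type) (lt : O -> O -> Prop).
Hypothesis Hwo : well_order lt.
Hypothesis Hreg : regular_uncountable_cardinal lt.
Variables (S : O -> Prop) (eta : O -> nat -> O).
Hypothesis etaP : forall d, S d -> ladder lt d (eta d).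
Hypothesis HSnr : non_reflecting lt S.
Variable Rl : (O -> bool) -> (O -> nat -> term O) -> O -> Prop.
Hypothesis RlS : forall A a d, Rl A a d -> S d.

Local Notation KK := (term_group eta Rl).
Local Notation cl := (cl : term O -> KK).

Lemma cl_relation A a d n : Rl A a d ->
  cl (Vt A a d n.+1) *+ 2 = cl (Vt A a d n) + cl (Ut A a (eta d n)) + cl (a d n).
Proof. by have [_ _ R] := cl_valuation eta Rl; move=> Rd; apply: R. Qed.

Section Level.
Variables (g : O) (h : O -> nat).
Hypothesis hP : disjoint_tails lt S eta g h.

Definition basic (t : term O) : Prop :=
  match t with
  | Gen _ => True
  | Ut A a x => forall d n, Rl A a d -> lt d g -> (h d <= n)%N -> eta d n <> x
  | Vt A a d n => Rl A a d -> lt d g /\ (h d <= n)%N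
  | _ => False
  end.

Lemma rat_solution (P : O -> Prop) (al wv : O -> nat -> rat) (wu : O -> rat) :
  (forall d, P d -> S d) -> exists uv : (O -> rat) * (O -> nat -> rat),
  [/\ forall d, P d -> forall n, uv.2 d n.+1 *+ 2 = uv.2 d n + uv.1 (eta d n) + al d n,
      forall x, (forall d n, P d -> lt d g -> (h d <= n)%N -> eta d n <> x) -> uv.1 x = wu x
    & forall d n, (P d -> lt d g /\ (h d <= n)%N) -> uv.2 d n = wv d n].
Proof.
move=> PS; have /choice [u uP] : forall x, exists y : rat,
  (forall d n, P d -> lt d g -> (h d <= n)%N -> eta d n = x ->
     y = wv d n.+1 *+ 2 - wv d n - al d n) /\
  ((forall d n, P d -> lt d g -> (h d <= n)%N -> eta d n <> x) -> y = wu x).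
  move=> x; have [[d [n [Pd dg hn dx]]]|N] :=
    pselect (exists d n, [/\ P d, lt d g, (h d <= n)%N & eta d n = x]).
    exists (wv d n.+1 *+ 2 - wv d n - al d n); split; last by move/(_ d n Pd dg hn).
    move=> d' n' Pd' dg' hn'; rewrite -dx => E; have dE := hP (PS _ Pd') (PS _ Pd) dg' dg hn' hn E.
    by move: E; rewrite dE => /(ladder_inj Hwo (etaP (PS _ Pd))) ->.
  exists (wu x); split=> // d n Pd dg hn dx; case: N; by exists d, n.
have /choice [v vP] : forall d, exists f : nat -> rat,
  (P d -> forall n, f n.+1 *+ 2 = f n + u (eta d n) + al d n) /\
  (forall n, (P d -> lt d g /\ (h d <= n)%N) -> f n = wv d n).
  move=> d; have [Pd|NP] := pselect (P d); last by exists (wv d).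
  have [f [fm fR]] := rat_recursion (fun n => u (eta d n) + al d n) (h d) (wv d (h d)).
  exists f; split=> [_ n|n]; first by rewrite fR addrA.
  move=> /(_ Pd) [dg]; elim: n => [|n IH]; first by rewrite leqn0 => /eqP E; rewrite -E.
  rewrite leq_eqVlt ltnS => /orP[/eqP<- //|hn].
  have := fR n; rewrite (IH hn) ((uP (eta d n)).1 d n Pd dg hn erefl); lra.
exists (u, v); split=> /= [d Pd n|x|d n]; first exact: (vP d).1.
  exact: (uP x).2.
exact: (vP d).2.
Qed.

Lemma exists_valuation (w : term O -> rat) :
  exists f : term O -> rat, valuation eta Rl f /\ forall t, basic t -> f t = w t.
Proof.
have /choice [sol solP] : forall i :
    (O -> Prop) * (O -> nat -> rat) * (O -> nat -> rat) * (O -> rat),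
  exists uv : (O -> rat) * (O -> nat -> rat), let: (P, al, wv, wu) := i in
  (forall d, P d -> S d) ->
  [/\ forall d, P d -> forall n, uv.2 d n.+1 *+ 2 = uv.2 d n + uv.1 (eta d n) + al d n,
      forall x, (forall d n, P d -> lt d g -> (h d <= n)%N -> eta d n <> x) -> uv.1 x = wu x
    & forall d n, (P d -> lt d g /\ (h d <= n)%N) -> uv.2 d n = wv d n].
  move=> [[[P al] wv] wu]; have [PS|] := pselect (forall d, P d -> S d); last first.
    by exists (fun=> 0, fun _ _ => 0).
  by have [uv uvP] := rat_solution al wv wu PS; exists uv.
pose f := fix f (t : term O) : rat := match t with
  | Zr => 0
  | Sb t s => f t - f s
  | Gen i => w (Gen i)
  | Ut A a x => (sol (Rl A a, fun d n => f (a d n), fun d n => w (Vt A a d n),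
                      fun x => w (Ut A a x))).1 x
  | Vt A a d n => (sol (Rl A a, fun d n => f (a d n), fun d n => w (Vt A a d n),
                      fun x => w (Ut A a x))).2 d n
  end.
have fP A a := solP (Rl A a, fun d n => f (a d n), fun d n => w (Vt A a d n),
                      fun x => w (Ut A a x)) (@RlS A a).
exists f; split; first by split=> // A a d Rd n; have [R _ _] := fP A a; apply: R.
case=> //= [A a x|A a d n] b; have [_ uE vE] := fP A a; [exact: uE|exact: vE].
Qed.

Definition basis (Z : term O -> Prop) (x : KK) := exists b, [/\ Z b, basic b & x = cl b].

Lemma dual_functional (x : KK) : exists F : KK -> rat, additive_fun F /\
  forall b, basic b -> F (cl b) = (cl b == x)%:R.
Proof.
have [f [fv fb]] := exists_valuation (fun t => (cl t == x)%:R).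
have [F [FA FE]] := valuation_lift fv; exists F; split=> // b Bb.
by rewrite FE fb.
Qed.

Lemma basis_independent Z : independent (basis Z).
Proof.
have /choice [F FP] := dual_functional.
apply: (dual_independent (F := F)) => [b _|b a _ [t [_ Bt ->]]]; first by case: (FP b).
by case: (FP b) => _ ->.
Qed.

Definition closed_terms (Z : term O -> Prop) :=
  [/\ forall t s, Z (Sb t s) -> Z t /\ Z s,
      forall A a x, Z (Ut A a x) -> forall d n, Rl A a d -> lt d g -> (h d <= n)%N ->
        eta d n = x -> (forall k, Z (Vt A a d k)) /\ Z (a d n)
    & forall A a d n, Z (Vt A a d n) -> Rl A a d ->
        lt d g /\ forall k, [/\ Z (Vt A a d k), Z (Ut A a (eta d k)) & Z (a d k)]].

Lemma closed_span Z t : closed_terms Z -> Z t -> zspan (basis Z) (cl t).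
Proof.
move=> [ZS ZU ZV]; have sg := zspan_subgroup (basis Z).
have bas b : Z b -> basic b -> zspan (basis Z) (cl b).
  by move=> Zb Bb; apply: zspan_gen; exists b.
have Vhigh A a d n : Z (Vt A a d n) -> (h d <= n)%N -> zspan (basis Z) (cl (Vt A a d n)).
  by move=> Zt hn; apply: bas => //= Rd; split=> //; have [] := ZV _ _ _ _ Zt Rd.
have Uspan A a : (forall d n, Z (a d n) -> zspan (basis Z) (cl (a d n))) ->
    forall x, Z (Ut A a x) -> zspan (basis Z) (cl (Ut A a x)).
  move=> IH x Zx; have [B|NB] := pselect (basic (Ut A a x)); first exact: bas.
  have [d [n [Rd dg hn dx]]] : exists d n, [/\ Rl A a d, lt d g, (h d <= n)%N & eta d n = x].
    by apply: contrapT => N; apply: NB => d n Rd dg hn dx; apply: N; exists d, n.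
  have [ZVk Za] := ZU _ _ _ Zx d n Rd dg hn dx; rewrite -dx.
  have -> : cl (Ut A a (eta d n)) = cl (Vt A a d n.+1) *+ 2 - cl (Vt A a d n) - cl (a d n).
    by rewrite cl_relation // -[_ + _ + cl (a d n)]addrA [cl (Vt A a d n) + _]addrC !addrK.
  rewrite pmulrn; apply: (subgroupB sg); last exact: IH.
  apply: (subgroupB sg); last exact: Vhigh.
  by apply: (subgroupMz sg); apply: Vhigh => //; apply: leqW.
elim: t => [_|t IHt s IHs /ZS[Zt Zs]|i Zi|A a IH x Zx|A a IH d n Zn].
- exact: (subgroup0 sg).
- by rewrite cl_sub; apply: (subgroupB sg); [apply: IHt|apply: IHs].
- exact: bas.
- exact: Uspan.
- have [Rd|NR] := pselect (Rl A a d); last exact: bas.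
  have [dg Zk] := ZV _ _ _ _ Zn Rd.
  have Zspan k m : (h d <= m + k)%N -> zspan (basis Z) (cl (Vt A a d m)).
    elim: k m => [|k IHk] m; first by rewrite addn0; apply: Vhigh; case: (Zk m).
    rewrite addnS -addSn => /IHk IHm; have [_ Zu Za] := Zk m.
    have -> : cl (Vt A a d m) = cl (Vt A a d m.+1) *+ 2 - cl (Ut A a (eta d m)) - cl (a d m).
      by rewrite cl_relation // [_ + cl (a d m)]addrAC !addrK.
    rewrite pmulrn; apply: (subgroupB sg); last exact: IH.
    apply: (subgroupB sg); last exact: Uspan.
    exact: (subgroupMz sg).
  by apply: (Zspan (h d)); apply: leq_addl.
Qed.

(* If [w] is the solution of a recursion [2 w(n+1) = w(n) + u(n)] with all [u(n)] in the
   span of a closed set of terms, then the coordinates of [w(0)] outside of that span are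
   divisible by all powers of [2]. *)
Lemma recursion_in_span Y Z (w u : nat -> KK) :
  (forall n, w n.+1 *+ 2 = w n + u n) -> (forall n, zspan (basis Y) (w n)) ->
  (forall n, zspan (basis Z) (u n)) -> forall n, zspan (basis Z) (w n).
Proof.
move=> wR wY uZ n0; have [f [s [us sY f0 wE]]] := wY n0.
have sg := zspan_subgroup (basis Z).
rewrite wE; apply: (subgroup_sum sg) => x xs.
have [Zx|NZx] := pselect (basis Z x); first by apply: (subgroupMz sg); apply: zspan_gen.
suff -> : f x = 0 by rewrite mulr0z; apply: (subgroup0 sg).
have [F [FA Fb]] := dual_functional x.
have FY y : basis Y y -> F y = (y == x)%:R by move=> [b [_ Bb ->]]; apply: Fb.
have Fu n : F (u n) = 0.
  apply: (zspan_min (H := fun y => F y = 0) _ _ (uZ n)) => [|y By].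
    split; first exact: additive_fun0.
      by move=> y z Fy Fz; rewrite additive_funD // Fy Fz addr0.
    by move=> y Fy; rewrite additive_funN // Fy oppr0.
  have [b [Zb Bb yE]] := By; rewrite yE Fb // -yE; case: eqP => // E.
  by case: NZx; rewrite -E.
have xY := sY x xs.
have Fw n : exists k : int, F (w n) = k%:~R.
  by have [f' wf'] := wY n; exists (f' x); apply: dual_coordinate FA xY FY wf'.
have [k kP] := choice Fw.
have kR n : k n.+1 * 2 = k n.
  apply: (@intr_inj rat); rewrite intrM -!kP -[RHS]addr0 -(Fu n) -(additive_funD FA) -wR.
  by rewrite mulrzr [w n.+1 *+ 2]mulr2n (additive_funD FA).
have kpow n m : k (n + m)%N * 2 ^+ m = k n.
  elim: m => [|m IH]; first by rewrite addn0 expr0 mulr1.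
  by rewrite -IH -[in RHS]kR exprS addnS mulrA.
have wf : repr_by (basis Y) (w n0) f by exists s.
have := dual_coordinate FA xY FY wf; rewrite kP => /intr_inj <-.
have := kpow n0 `|k n0|%N; set q := k (_ + _)%N => E; apply/eqP; apply: contraT => kn.
have : (2 ^ `|k n0| <= `|k n0|)%N.
  rewrite -{2}E abszM abszX; have : (0 < `|q|)%N.
    by rewrite absz_gt0; apply: contraNneq kn => q0; rewrite -E q0 mul0r.
  by move=> ?; rewrite leq_pmull.
by rewrite leqNgt ltn_expl.
Qed.

End Level.

Fixpoint low (g : O) (t : term O) : Prop := match t with
  | Zr => True
  | Sb t s => low g t /\ low g s
  | Gen _ => True
  | Ut A a x => forall d, Rl A a d -> lt d g -> forall n, low g (a d n)
  | Vt A a d n => Rl A a d -> lt d g /\ forall d', Rl A a d' -> lt d' g -> forall n, low g (a d' n)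
  end.

Lemma low_closed g h : closed_terms g h (low g).
Proof.
split=> [//|A a x /= Zx d n Rd dg _ _|A a d n /= Zn Rd].
  by split=> [k _|]; [split|apply: Zx].
have [dg Za] := Zn Rd; split=> // k; split=> //; exact: Za.
Qed.

Local Notation clubO := (club lt (fun=> True)).

Lemma club_low t : exists C, clubO C /\ forall g, C g -> low g t.
Proof.
have clubR (a : O -> nat -> term O) :
    (forall d n, exists C, clubO C /\ forall g, C g -> low g (a d n)) ->
    exists C, clubO C /\ forall g, C g -> forall d, lt d g -> forall n, low g (a d n).
  move=> IH; have /choice [C CP] : forall i : O * nat,
    exists C, clubO C /\ forall g, C g -> low g (a i.1 i.2).
    by move=> [d n]; apply: IH.
  pose act (i : O * nat) g := lt i.1 g.
  exists (fun g => limit_ord lt g /\ forall i, act i g -> C i g); split.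
    apply: (club_inter Hwo Hreg) => [b|i x y ix xy|i b ib [_ lim]|i]; last by case: (CP i).
    - pose p (i : {x : {x | lt x b} & nat}) : {i : O * nat | act i b} :=
        exist _ (sval (projT1 i), projT2 i) (proj2_sig (projT1 i)).
      apply: (bounded_index_surj (p := p)) => [|[[d n] db]].
        apply: (bounded_index_dep Hwo) => [|_]; first exact: bounded_index_segment.
        exact: bounded_index_nat.
      by exists (existT _ (exist _ d db) n); apply: sval_injective.
    - exact: (lt_tr Hwo ix xy).
    - by have [c [ic cb]] := lim _ ib; exists c.
  by move=> g [_ Cg] d dg n; apply: (proj2 (CP (d, n))); apply: Cg.
have clubT := club_True Hwo Hreg.
elim: t => [|t [C [CC Ct]] s [D [CD Ds]]|i|A a /clubR [C [CC Ca]] x|A a /clubR [C [CC Ca]] d n].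
- by exists (fun=> True).
- exists (fun b => [/\ limit_ord lt b, C b & D b]); split; first exact: club_and.
  by move=> g [_ /Ct ? /Ds ?].
- by exists (fun=> True).
- by exists C; split=> // g Cg /= d' _ dg; apply: Ca.
- exists (fun b => [/\ limit_ord lt b, lt d b & C b]); split.
    by apply: club_and => //; apply: club_above.
  by move=> g [_ dg Cg] /= _; split=> // d' _ d'g; apply: Ca.
Qed.

Lemma exists_low (I : Type) (t : I -> term O) (b : O) : bounded_index lt I ->
  exists g, lt b g /\ forall i, low g (t i).
Proof.
move=> bI; have /choice [C CP] := fun i => club_low (t i).
have clubI : clubO (fun g => limit_ord lt g /\ forall i, True -> C i g).
  apply: (club_inter Hwo Hreg) => [_|//|i c _ [[a ac] _]|i]; [|by exists a|by case: (CP i)].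
  apply: (bounded_index_surj (p := fun i => exist _ i Logic.I) bI) => -[i []].
  by exists i.
case: clubI => _ unb _; have [g [[_ Cg] bg]] := unb b Logic.I.
by exists g; split=> // i; apply: (proj2 (CP i)); apply: Cg.
Qed.

Lemma low_free g : free_subgroup (fun x : KK => exists t, low g t /\ x = cl t).
Proof.
have [h hP] := exists_disjoint_tails Hwo etaP HSnr g; exists (basis g h (low g)).
apply/free_basisP; split; last exact: basis_independent.
  by move=> _ [b [lb _ ->]]; exists b.
by move=> _ [t [lt_ ->]]; apply: closed_span (low_closed g h) lt_.
Qed.

Lemma term_group_lambda_free : lambda_free O KK.
Proof.
move=> H HH NH; have bH : bounded_index lt {x | H x}.
  apply: (bounded_index_no_injection Hwo Hreg) => -[f fI]; apply: NH.
  exists (fun o => sval (f o)); split=> [x y /sval_injective/fI //|o].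
  exact: proj2_sig (f o).
have /choice [r rP] := cl_surj (eta := eta) (Rl := Rl).
have [b0] := ord_inhabited Hreg.
have [g [_ gH]] := exists_low (fun x : {x | H x} => r (sval x)) b0 bH.
apply: subgroup_of_free (low_free g) HH _ => x Hx.
exists (r x); rewrite rP; split=> //; exact: (gH (exist _ x Hx)).
Qed.

Lemma rational_separation (x : KK) : x <> 0 -> exists F : KK -> rat, additive_fun F /\ F x <> 0.
Proof.
have [t <-] := cl_surj x => tn0.
have [b0] := ord_inhabited Hreg.
have [g [_ gt]] := exists_low (fun _ : unit => t) b0 (bounded_index_unit Hwo Hreg).
have [h hP] := exists_disjoint_tails Hwo etaP HSnr g.
have [f [s [us sB f0 tE]]] := closed_span (low_closed g h) (gt tt).
have [a [as_ fa]] : exists a, a \in s /\ f a <> 0.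
  apply: contrapT => N; apply: tn0; rewrite tE big_seq big1 // => a as_.
  have [->|fa] := pselect (f a = 0); first by rewrite mulr0z.
  by case: N; exists a.
have [F [FA Fb]] := dual_functional hP a; exists F; split=> //.
have tf : repr_by (basis g h (low g)) (cl t) f by exists s.
rewrite (dual_coordinate FA (sB a as_) _ tf); first by move=> /eqP; rewrite intr_eq0 => /eqP.
by move=> _ [b [_ Bb ->]]; apply: Fb.
Qed.

Lemma integral_functional (I : Type) (t : I -> term O) i : bounded_index lt I ->
  exists F : KK -> rat, [/\ additive_fun F, F (cl (Gen i)) = 1 &
    forall j, exists k : int, F (cl (t j)) = k%:~R].
Proof.
move=> bI; have [b0] := ord_inhabited Hreg.
have [g [_ gt]] := exists_low t b0 bI.
have [h hP] := exists_disjoint_tails Hwo etaP HSnr g.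
have [F [FA Fb]] := dual_functional hP (cl (Gen i)); exists F; split=> //.
  by rewrite Fb // eqxx.
move=> j; have [f tf] := closed_span (low_closed g h) (gt j).
exists (f (cl (Gen i))); apply: dual_coordinate FA _ _ tf; first by exists (Gen i).
by move=> _ [b [_ Bb ->]]; apply: Fb.
Qed.

End Basis.

(** * Extensions of ladder groups *)

Inductive word (O : Type) : Type :=
| Wz : word O
| Ws : word O -> word O -> word O
| Wu : O -> word O
| Wv : O -> nat -> word O.
Arguments Wz {O}.

Section LadderGroup.
Variables (O : Type) (eta : O -> nat -> O) (P : O -> Prop).

Fixpoint ev (W : zmodType) (u : O -> W) (v : O -> nat -> W) (x : word O) : W :=
  match x with
  | Wz => 0
  | Ws x y => ev u v x - ev u v y
  | Wu n => u n
  | Wv d n => v d n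
  end.

Definition solves (W : zmodType) (a : O -> nat -> W) (u : O -> W) (v : O -> nat -> W) :=
  forall d, P d -> forall n, v d n.+1 *+ 2 = v d n + u (eta d n) + a d n.

Definition solvable (W : zmodType) := forall a : O -> nat -> W, exists u v, solves a u v.

Definition evaluation (W : zmodType) (f : word O -> W) :=
  exists u v, solves (fun _ _ => 0) u v /\ f = ev u v.

Lemma evaluation_zero (W : zmodType) (f : word O -> W) : evaluation f -> f Wz = 0.
Proof. by move=> [u [v [_ ->]]]. Qed.

Lemma evaluation_sub (W : zmodType) (f : word O -> W) :
  evaluation f -> forall x y, f (Ws x y) = f x - f y.
Proof. by move=> [u [v [_ ->]]]. Qed.

Definition ladder_congruence := hom_congruence evaluation_zero evaluation_sub.
Definition ladder_group : zmodType := quot ladder_congruence.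
Definition wcl (x : word O) : ladder_group := @class ladder_congruence x.

Lemma wcl_surj g : exists x, wcl x = g.
Proof. exact: (@class_surj ladder_congruence). Qed.

Lemma wclP x y : wcl x = wcl y <->
  forall (W : zmodType) (u : O -> W) (v : O -> nat -> W), solves (fun _ _ => 0) u v ->
  ev u v x = ev u v y.
Proof.
split=> [/hom_classP H W u v s|H]; first by apply: H; exists u, v.
by apply/hom_classP => W f [u [v [s ->]]]; apply: H.
Qed.

Lemma wcl_sub x y : wcl (Ws x y) = wcl x - wcl y.
Proof. exact: (@class_sub ladder_congruence). Qed.

Lemma wcl_solves : solves (fun _ _ => 0) (fun n => wcl (Wu n)) (fun d n => wcl (Wv d n)).
Proof.
move=> d Pd n.
have ad x y : wcl x + wcl y = wcl (Ws x (Ws Wz y)).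
  by rewrite !wcl_sub [wcl Wz](_ : _ = 0) // sub0r opprK.
rewrite addr0 mulr2n !ad; apply/wclP => W u v /(_ d Pd n) /=.
by rewrite addr0 !sub0r !opprK mulr2n.
Qed.

Lemma ladder_group_universal (W : zmodType) (u : O -> W) (v : O -> nat -> W) :
  solves (fun _ _ => 0) u v ->
  exists g : ladder_group -> W, additive_fun g /\ forall x, g (wcl x) = ev u v x.
Proof. by move=> s; apply: hom_congruence_lift; exists u, v. Qed.

Lemma additive_ev (V W : zmodType) (f : V -> W) u v x : additive_fun f ->
  f (ev u v x) = ev (fun n => f (u n)) (fun d n => f (v d n)) x.
Proof.
move=> fA; elim: x => //= [|x IHx y IHy]; first exact: additive_fun0.
by rewrite fA IHx IHy.
Qed.

Lemma ev_wcl x : ev (fun n => wcl (Wu n)) (fun d n => wcl (Wv d n)) x = wcl x.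
Proof. by elim: x => //= x -> y ->; rewrite wcl_sub. Qed.

Lemma Ext_zero_of_solvable (K : zmodType) : solvable K -> Ext_zero ladder_group K.
Proof.
move=> Ksol E i p iA pA iI pS ker; have [s ps] := choice pS.
pose x n := s (wcl (Wu n)); pose y d n := s (wcl (Wv d n)).
have /choice [a aP] : forall dn : O * nat, exists k, P dn.1 ->
    i k = - (y dn.1 dn.2.+1 *+ 2 - y dn.1 dn.2 - x (eta dn.1 dn.2)).
  move=> [d n] /=; have [Pd|NP] := pselect (P d); last by exists 0.
  have /ker [k kE] : p (- (y d n.+1 *+ 2 - y d n - x (eta d n))) = 0; last by exists k.
  rewrite (additive_funN pA) !pA mulr2n (additive_funD pA) /y /x !ps -mulr2n wcl_solves // addr0.
  by rewrite [wcl (Wv d n) + _]addrC !addrK subrr oppr0.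
have [u [v uv]] := Ksol (fun d n => a (d, n)).
have [g [gA gE]] : exists g : ladder_group -> E, additive_fun g /\
    forall w, g (wcl w) = ev (fun n => x n + i (u n)) (fun d n => y d n + i (v d n)) w.
  apply: ladder_group_universal => d Pd n; rewrite addr0 mulr2n addrACA -!mulr2n.
  rewrite [i _ *+ 2]mulr2n -(additive_funD iA) -mulr2n (uv d Pd n) !(additive_funD iA).
  rewrite (aP (d, n)) //= !opprB.
  set A := y d n.+1 *+ 2; set B := y d n; set C := x _; set I := i _; set J := i _.
  rewrite [C + (B - A)]addrA [I + J + _]addrA [A + _]addrC subrK.
  by rewrite [LHS]addrC [C + B]addrC addrACA.
exists g; split=> // q; have [w <-] := wcl_surj q; rewrite gE additive_ev //.
rewrite -[RHS]ev_wcl; congr (ev _ _ w).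
  apply/funext => n; rewrite (additive_funD pA) ps.
  by rewrite (_ : p (i (u n)) = 0) ?addr0 //; apply/ker; exists (u n).
apply/funext => d; apply/funext => n; rewrite (additive_funD pA) ps.
by rewrite (_ : p (i (v d n)) = 0) ?addr0 //; apply/ker; exists (v d n).
Qed.

Section Extension.
Variables (K : zmodType) (a : O -> nat -> K).

(* The extension of [ladder_group] by [K] in which the generators satisfy the relations
   deformed by [a]. *)
Definition deformation (W : zmodType) (f : K * word O -> W) := exists (j : K -> W) u v,
  [/\ additive_fun j, solves (fun d n => j (a d n)) u v & f = fun kx => j kx.1 + ev u v kx.2].

Lemma deformation_zero (W : zmodType) (f : K * word O -> W) :
  deformation f -> f (0, Wz) = 0.
Proof. by move=> [j [u [v [jA _ ->]]]] /=; rewrite addr0 additive_fun0. Qed.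

Definition deformation_minus (x y : K * word O) := (x.1 - y.1, Ws x.2 y.2).

Lemma deformation_sub (W : zmodType) (f : K * word O -> W) :
  deformation f -> forall x y, f (deformation_minus x y) = f x - f y.
Proof.
by move=> [j [u [v [jA _ ->]]]] x y /=; rewrite jA opprD addrACA.
Qed.

Definition ext_congruence := hom_congruence deformation_zero deformation_sub.
Definition ext_group : zmodType := quot ext_congruence.
Definition ecl (x : K * word O) : ext_group := @class ext_congruence x.

Lemma ecl_surj e : exists x, ecl x = e.
Proof. exact: (@class_surj ext_congruence). Qed.

Lemma eclP x y : ecl x = ecl y <->
  forall (W : zmodType) (j : K -> W) (u : O -> W) (v : O -> nat -> W),
    additive_fun j -> solves (fun d n => j (a d n)) u v ->
  j x.1 + ev u v x.2 = j y.1 + ev u v y.2.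
Proof.
split=> [/hom_classP H W j u v jA s|H].
  by apply: (H W (fun kx => j kx.1 + ev u v kx.2)); exists j, u, v.
by apply/hom_classP => W f [j [u [v [jA s ->]]]]; apply: H.
Qed.

Lemma ecl_sub x y : ecl (deformation_minus x y) = ecl x - ecl y.
Proof. exact: (@class_sub ext_congruence). Qed.

Lemma ecl_add x y : ecl x + ecl y = ecl (deformation_minus x (deformation_minus (0, Wz) y)).
Proof. by rewrite !ecl_sub [ecl (0, Wz)](_ : _ = 0) // sub0r opprK. Qed.

Definition einj (k : K) : ext_group := ecl (k, Wz).
Definition eword (x : word O) : ext_group := ecl (0, x).

Lemma einj_additive : additive_fun einj.
Proof.
move=> k l; rewrite /einj -ecl_sub; apply/eclP => W j u v jA _ /=.
by rewrite subrr.
Qed.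

Lemma ecl_decomposition k x : ecl (k, x) = einj k + eword x.
Proof.
rewrite /einj /eword ecl_add; apply/eclP => W j u v jA _ /=.
by rewrite !(jA, additive_fun0 jA) !subr0 !sub0r opprK.
Qed.

Lemma eword_sub x y : eword (Ws x y) = eword x - eword y.
Proof.
rewrite /eword -ecl_sub; apply/eclP => W j u v jA _ /=.
by rewrite subr0.
Qed.

Lemma eword_solves :
  solves (fun d n => einj (a d n)) (fun n => eword (Wu n)) (fun d n => eword (Wv d n)).
Proof.
move=> d Pd n; rewrite mulr2n /eword /einj !ecl_add; apply/eclP => W j u v jA /(_ d Pd n) /=.
rewrite !(jA, additive_fun0 jA) !sub0r !opprK addr0 add0r mulr2n => ->.
by rewrite add0r addrC.
Qed.

Lemma einj_injective :
  (forall x : K, x <> 0 -> exists F : K -> rat, additive_fun F /\ F x <> 0) -> injective einj.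
Proof.
move=> sep k l /eclP H; apply: contrapT => kl.
have [F [FA]] : exists F : K -> rat, additive_fun F /\ F (k - l) <> 0.
  by apply: sep => /eqP; rewrite subr_eq0 => /eqP.
have /choice [v vP] : forall d, exists v : nat -> rat, forall n, v n.+1 *+ 2 = v n + F (a d n).
  by move=> d; have [v [_ vR]] := rat_recursion (fun n => F (a d n)) 0%N 0; exists v.
have := H rat F (fun=> 0) v FA; rewrite /= !addr0 FA => -> //.
  by rewrite subrr.
by move=> d _ n; rewrite addr0.
Qed.

Lemma ext_projection : exists p : ext_group -> ladder_group,
  [/\ additive_fun p, forall k x, p (ecl (k, x)) = wcl x &
    forall e, p e = 0 <-> exists k, einj k = e].
Proof.
have [p [pA pE]] : exists p : ext_group -> ladder_group, additive_fun p /\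
    forall x, p (ecl x) = 0 + ev (fun n => wcl (Wu n)) (fun d n => wcl (Wv d n)) x.2.
  apply: (@hom_congruence_lift _ _ _ _ deformation_zero deformation_sub ladder_group
    (fun x => 0 + ev (fun n => wcl (Wu n)) (fun d n => wcl (Wv d n)) x.2)).
  exists (fun=> 0), (fun n => wcl (Wu n)), (fun d n => wcl (Wv d n)); split=> //.
    by move=> x y; rewrite subr0.
  exact: wcl_solves.
have pw k x : p (ecl (k, x)) = wcl x by rewrite pE add0r ev_wcl.
exists p; split=> // e; split=> [|[k <-]]; last by rewrite pw.
have [[k x] <-] := ecl_surj e; rewrite pw => x0.
pose H e := exists k, einj k = e.
have HH : subgroup H.
  split; first by exists 0; apply: additive_fun0 einj_additive.
    by move=> _ _ [l <-] [m <-]; exists (l + m); apply: additive_funD einj_additive _ _.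
  by move=> _ [l <-]; exists (- l); apply: additive_funN einj_additive _.
pose D := subgroup_congruence HH; pose pi := @class D : ext_group -> quot D.
have piA : additive_fun pi by move=> e1 e2; apply: class_sub.
have piH l : pi (einj l) = 0.
  by rewrite -[0](class_zero D); apply/cosetP; exists l; rewrite subr0.
have [g [gA gE]] : exists g : ladder_group -> quot D, additive_fun g /\
    forall w, g (wcl w) = ev (fun n => pi (eword (Wu n))) (fun d n => pi (eword (Wv d n))) w.
  apply: ladder_group_universal => d Pd n.
  rewrite mulr2n -[X in X = _](additive_funD piA) -mulr2n eword_solves //.
  by rewrite !(additive_funD piA) piH.
have evw w : ev (fun n => eword (Wu n)) (fun d n => eword (Wv d n)) w = eword w.
  elim: w => //= w -> w' ->; by rewrite eword_sub.
have : pi (eword x) = pi 0.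
  by rewrite -[eword x]evw additive_ev // -gE x0 !additive_fun0.
move=> /cosetP [l]; rewrite subr0 => lE; exists (k + l).
by rewrite ecl_decomposition (additive_funD einj_additive) lE.
Qed.

End Extension.

Lemma solvable_of_Ext_zero (K : zmodType) :
  (forall x : K, x <> 0 -> exists F : K -> rat, additive_fun F /\ F x <> 0) ->
  Ext_zero ladder_group K -> solvable K.
Proof.
move=> sep EK a; have [p [pA pE ker]] := ext_projection a.
have [|s [sA ps]] := EK _ _ p (einj_additive a) pA (einj_injective sep) _ ker.
  by move=> x; have [w <-] := wcl_surj x; exists (eword a w); rewrite pE.
have /choice [k kP] : forall w, exists k, einj a k = eword a w - s (wcl w).
  by move=> w; apply/ker; rewrite pA ps pE subrr.
exists (fun n => k (Wu n)), (fun d n => k (Wv d n)) => d Pd n.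
apply: (@einj_injective K a sep).
rewrite mulr2n !(additive_funD (einj_additive a)) !kP addrACA -!mulr2n eword_solves //.
rewrite mulNrn [s _ *+ 2]mulr2n -(additive_funD sA) -mulr2n wcl_solves // addr0 (additive_funD sA).
by rewrite opprD addrAC addrACA.
Qed.

End LadderGroup.

(** * Freeness and cardinality *)

Lemma lambda_free_embedding (O : Type) (V W : zmodType) (f : V -> W) :
  additive_fun f -> injective f -> lambda_free O W -> lambda_free O V.
Proof.
move=> fA fI Wfree H HH NH; pose fH y := exists x, H x /\ y = f x.
have fHH : subgroup fH.
  split; first by exists 0; rewrite additive_fun0 //; split=> //; apply: subgroup0.
    move=> _ _ [x [Hx ->]] [y [Hy ->]]; exists (x + y).
    by rewrite additive_funD //; split=> //; apply: subgroupD.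
  by move=> _ [x [Hx ->]]; exists (- x); rewrite additive_funN //; split=> //; apply: subgroupN.
have [|B /free_basisP [BH HB iB]] := Wfree fH fHH.
  move=> [k [kI kH]]; apply: NH; have [r rP] := choice kH.
  exists r; split=> [x y E|o]; last by case: (rP o).
  by apply: kI; have [_ ->] := rP x; have [_ ->] := rP y; rewrite E.
exists (fun x => H x /\ B (f x)); apply/free_basisP; split=> [x []//|x Hx|c [s [us sB c0 sE]] a].
  have sg := zspan_subgroup (fun x => H x /\ B (f x)).
  have : (fun y => exists x', zspan (fun x => H x /\ B (f x)) x' /\ y = f x') (f x).
    apply: (zspan_min (H := fun y => exists x', zspan (fun x => H x /\ B (f x)) x' /\ y = f x')
      _ _ (HB (f x) _)).
    - split; first by exists 0; rewrite additive_fun0 //; split=> //; apply: (subgroup0 sg).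
        move=> _ _ [y [By ->]] [z [Bz ->]]; exists (y + z).
        by rewrite additive_funD //; split=> //; apply: (subgroupD sg).
      move=> _ [y [By ->]]; exists (- y); rewrite additive_funN //.
      split=> //; exact: (subgroupN sg).
    - move=> b Bb; have [y [Hy yb]] := BH b Bb; exists y; split=> //.
      by apply: zspan_gen; rewrite -yb.
    - by exists x.
  by move=> [x' [Bx' /fI ->]].
have [as_|/c0//] := boolP (a \in s).
have /choice [r rP] : forall y, exists x, (exists x, f x = y) -> f x = y.
  by move=> y; have [[x <-]|N] := pselect (exists x, f x = y); [exists x|exists 0].
have rK x : r (f x) = x by apply: fI; apply: rP; exists x.
pose c' y := if y \in map f s then c (r y) else 0.
have c'E x : x \in s -> c' (f x) = c x by move=> xs; rewrite /c' map_f // rK.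
rewrite -c'E //; apply: iB; exists (map f s); split.
- by rewrite map_inj_uniq.
- by move=> _ /mapP [x /sB [_ Bx] ->].
- by move=> y ys; rewrite /c' (negPf ys).
rewrite big_map; transitivity (f 0); first by rewrite additive_fun0.
rewrite [in LHS]sE additive_fun_sum //; apply: eq_big_seq => x xs.
by rewrite additive_funMz // c'E.
Qed.

Section LadderGroupFree.
Variables (O : Type) (lt : O -> O -> Prop).
Hypothesis Hwo : well_order lt.
Hypothesis Hreg : regular_uncountable_cardinal lt.
Variables (S : O -> Prop) (eta : O -> nat -> O).
Hypothesis etaP : forall d, S d -> ladder lt d (eta d).
Hypothesis HSnr : non_reflecting lt S.
Variable P : O -> Prop.
Hypothesis PS : forall d, P d -> S d.

Let A0 : O -> bool := fun=> false.
Let a0 : O -> nat -> term O := fun _ _ => Zr.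
Let Rl0 A a d := [/\ A = A0, a = a0 & P d].

(* [ladder_group] sits inside the term group with a single constrained node. *)
Lemma ladder_group_embedding :
  exists f : ladder_group eta P -> term_group eta Rl0, additive_fun f /\ injective f.
Proof.
have [f [fA fE]] : exists f : ladder_group eta P -> term_group eta Rl0, additive_fun f /\
    forall x, f (wcl eta P x) = ev (fun n => cl (Ut A0 a0 n)) (fun d n => cl (Vt A0 a0 d n)) x.
  apply: ladder_group_universal => d Pd n.
  by have [_ _ ->] := cl_valuation eta Rl0.
exists f; split=> // q q'; have [x <-] := wcl_surj q; have [y <-] := wcl_surj q'.
rewrite !fE => E; apply/wclP => W u v sol.
pose g := fix g (t : term O) : W := match t with
  | Sb t s => g t - g s
  | Ut A a n => if pselect (A = A0 /\ a = a0) then u n else 0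
  | Vt A a d n => if pselect (A = A0 /\ a = a0) then v d n else 0
  | _ => 0
  end.
have gv : valuation eta Rl0 g.
  split=> // A a d [-> -> Pd] n /=; case: pselect => [?|[]//].
  exact: sol.
have [k [kA kE]] := valuation_lift gv.
have kx z : k (ev (fun n => cl (Ut A0 a0 n)) (fun d n => cl (Vt A0 a0 d n)) z) = ev u v z.
  rewrite additive_ev //; congr (ev _ _ z).
    by apply/funext => n; rewrite kE /=; case: pselect => [?|[]].
  by apply/funext => d; apply/funext => n; rewrite kE /=; case: pselect => [?|[]].
by rewrite -!kx E.
Qed.

Lemma ladder_group_lambda_free : lambda_free O (ladder_group eta P).
Proof.
have [f [fA fI]] := ladder_group_embedding.
apply: lambda_free_embedding fA fI _.
by apply: (term_group_lambda_free Hwo Hreg etaP HSnr) => A a d [_ _ /PS].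
Qed.

End LadderGroupFree.

Section Cardinalities.
Variables (O : Type) (pr : O -> O -> O) (on : nat -> O).
Hypothesis prI : forall x y x' y', pr x y = pr x' y' -> x = x' /\ y = y'.
Hypothesis onI : injective on.

Fixpoint word_code (x : word O) : O := match x with
  | Wz => pr (on 0) (on 0)
  | Ws x y => pr (on 1) (pr (word_code x) (word_code y))
  | Wu n => pr (on 2) n
  | Wv d n => pr (on 3) (pr d (on n))
  end.

Lemma word_code_injective : injective word_code.
Proof.
elim=> [|x IHx y IHy|n|d n] [|x' y'|n'|d' n'] //= /prI [/onI E] //.
- by move=> /prI [/IHx -> /IHy ->].
- by move=> ->.
- by move=> /prI [-> /onI ->].
Qed.

Variables (eta : O -> nat -> O) (P : O -> Prop).

Lemma ladder_group_card : exists f : ladder_group eta P -> O, bijective f.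
Proof.
have /choice [r rP] := @wcl_surj O eta P.
apply: (injections_bijective (f := fun q => word_code (r q)) (g := fun n => wcl eta P (Wu n))).
  by move=> q q' /word_code_injective E; rewrite -(rP q) -(rP q') E.
move=> m n /wclP E; apply: contrapT => mn.
pose u x : rat := (`[<x = m>])%:R.
have /choice [v vP] : forall d, exists v : nat -> rat, forall n, v n.+1 *+ 2 = v n + u (eta d n).
  by move=> d; have [v [_ vR]] := rat_recursion (fun n => u (eta d n)) 0%N 0; exists v.
have := E rat u v; rewrite /= /u asboolT // asboolF; last by move/esym.
by move=> /(_ (fun d _ n => etrans (vP d n) (esym (addr0 _))))/eqP.
Qed.

(* Terms are coded by sets of ordinals: a family of sets [f] is coded by the set of
   pairs [(k, z)] with [z] in [f k]. *)
Let join (f : nat -> O -> Prop) (y : O) := exists k z, f k z /\ y = pr (on k) z.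
Let join2 (f : O -> nat -> O -> Prop) (y : O) := exists d n z, f d n z /\ y = pr d (pr (on n) z).

Let joinI f g : join f = join g -> forall k, f k = g k.
Proof.
have sub f' g' k z : join f' = join g' -> f' k z -> g' k z.
  move=> E fz; have : join g' (pr (on k) z) by rewrite -E; exists k, z.
  by move=> [k' [z' [gz /prI[/onI -> ->]]]].
by move=> E k; apply/funext => z; apply/propext; split; apply: sub.
Qed.

Let join2I f g : join2 f = join2 g -> forall d n, f d n = g d n.
Proof.
have sub f' g' d n z : join2 f' = join2 g' -> f' d n z -> g' d n z.
  move=> E fz; have : join2 g' (pr d (pr (on n) z)) by rewrite -E; exists d, n, z.
  by move=> [d' [n' [z' [gz /prI[-> /prI[/onI -> ->]]]]]].
by move=> E d n; apply/funext => z; apply/propext; split; apply: sub.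
Qed.

Let tuple4 (t : nat) (B C D : O -> Prop) (k : nat) (z : O) : Prop :=
  match k with 0 => z = on t | 1 => B z | 2 => C z | _ => D z end.

Let tuple4I t B C D t' B' C' D' : join (tuple4 t B C D) = join (tuple4 t' B' C' D') ->
  [/\ t = t', B = B', C = C' & D = D'].
Proof.
move=> /joinI E; have := E 0%N; have EB := E 1%N; have EC := E 2%N; have ED := E 3%N.
move=> Et; split=> //; apply: onI; have : tuple4 t B C D 0 (on t) by [].
by rewrite Et.
Qed.

Fixpoint term_code (t : term O) : O -> Prop := match t with
  | Zr => join (tuple4 0 (fun=> True) (fun=> True) (fun=> True))
  | Sb t s => join (tuple4 1 (term_code t) (term_code s) (fun=> True))
  | Gen i => join (tuple4 2 i (fun=> True) (fun=> True))
  | Ut A a x => join (tuple4 3 A (eq x) (join2 (fun d n => term_code (a d n))))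
  | Vt A a d n => join (tuple4 4 A (eq (pr d (on n))) (join2 (fun d n => term_code (a d n))))
  end.

Lemma term_code_injective : injective term_code.
Proof.
have boolI (i j : O -> bool) : (i : O -> Prop) = (j : O -> Prop) -> i = j.
  move=> E; apply/funext => x; have := congr1 (fun f => f x) E => /= Ex.
  by apply/idP/idP; rewrite Ex.
have eqI (x y : O) : eq x = eq y -> x = y by move=> E; rewrite E.
elim=> [|t IHt s IHs|i|A a IH x|A a IH d n] [|t' s'|i'|A' a' x'|A' a' d' n'] //= /tuple4I[] // _.
- by move=> /IHt -> /IHs ->.
- by move=> /boolI ->.
- move=> /boolI -> /eqI -> /join2I E; congr (Ut _ _ _).
  by apply/funext => d; apply/funext => n; apply: IH; apply: E.
- move=> /boolI -> /eqI /prI[-> /onI ->] /join2I E; congr (Vt _ _ _ _).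
  by apply/funext => k; apply/funext => m; apply: IH; apply: E.
Qed.

End Cardinalities.

Section TermGroupCardinality.
Variables (O : Type) (lt : O -> O -> Prop).
Hypothesis Hwo : well_order lt.
Hypothesis Hreg : regular_uncountable_cardinal lt.
Variables (S : O -> Prop) (eta : O -> nat -> O).
Hypothesis etaP : forall d, S d -> ladder lt d (eta d).
Hypothesis HSnr : non_reflecting lt S.
Variable Rl : (O -> bool) -> (O -> nat -> term O) -> O -> Prop.
Hypothesis RlS : forall A a d, Rl A a d -> S d.
Variables (pr : O -> O -> O) (on : nat -> O).
Hypothesis prI : forall x y x' y', pr x y = pr x' y' -> x = x' /\ y = y'.
Hypothesis onI : injective on.

Lemma term_group_card : exists f : term_group eta Rl -> (O -> bool), bijective f.
Proof.
have /choice [r rP] := cl_surj (eta := eta) (Rl := Rl).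
apply: (injections_bijective (f := fun q z => `[< term_code pr on (r q) z >])
  (g := fun i => cl (Gen i))).
  move=> q q' E; rewrite -(rP q) -(rP q'); congr cl.
  apply: (term_code_injective prI onI); apply/funext => z; apply/propext.
  by apply: asbool_eq_equiv; have /= := congr1 (fun f : O -> bool => f z) E.
move=> i j /clP E; apply: contrapT => ij.
have [g] := ord_inhabited Hreg.
have [h hP] := exists_disjoint_tails Hwo etaP HSnr g.
have [f [fv fE]] := exists_valuation Hwo etaP RlS hP
  (fun t => if t is Gen k then (`[<k = i>])%:R else 0).
have := E rat f fv; rewrite !fE // asboolT // asboolF; last by move/esym.
by move=> /eqP.
Qed.

End TermGroupCardinality.

(** * Diamond *)

Section Enumeration.
Variables (O : Type) (pr : O -> O -> O) (on : nat -> O).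
Hypothesis prI : forall x y x' y', pr x y = pr x' y' -> x = x' /\ y = y'.
Hypothesis onI : injective on.
Variables (T : Type) (base : O -> T) (op : nat -> T -> T -> O -> nat -> T).

Inductive recipe :=
| Base : O -> recipe
| Apply : nat -> recipe -> recipe -> O -> nat -> recipe.

Fixpoint recipe_value (r : recipe) : T := match r with
  | Base x => base x
  | Apply i r s x n => op i (recipe_value r) (recipe_value s) x n
  end.

Fixpoint recipe_code (r : recipe) : O := match r with
  | Base x => pr (on 0) x
  | Apply i r s x n =>
      pr (on 1) (pr (on i) (pr (recipe_code r) (pr (recipe_code s) (pr x (on n)))))
  end.

Lemma recipe_code_injective : injective recipe_code.
Proof.
elim=> [x|i r IHr s IHs x n] [x'|i' r' s' x' n'] /= /prI [/onI E] //; first by move=> ->.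
by move=> /prI [/onI -> /prI [/IHr -> /prI [/IHs -> /prI [-> /onI ->]]]].
Qed.

Lemma exists_enumeration : exists k : O -> T, (forall x, exists z, k z = base x) /\
  forall i x y w n, exists z, k z = op i (k x) (k y) w n.
Proof.
have /choice [r rP] : forall z, exists r, (exists s, recipe_code s = z) -> recipe_code r = z.
  by move=> z; have [[s <-]|N] := pselect (exists s, recipe_code s = z); [exists s|exists (Base z)].
have rK s : r (recipe_code s) = s by apply: recipe_code_injective; apply: rP; exists s.
exists (recipe_value \o r); split=> [x|i x y w n].
  by exists (recipe_code (Base x)); rewrite /comp rK.
by exists (recipe_code (Apply i (r x) (r y) w n)); rewrite /comp rK.
Qed.

End Enumeration.

(* [- z 0] would be the [2]-adic sum [1 + 4 + 4^2 + ... = -1/3]. *)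
Lemma no_alternating_recursion (z : nat -> int) :
  ~ forall n, z n.+1 * 2 = z n + (~~ odd n)%:R.
Proof.
move=> zR; pose y n := z n.*2 * 3 - 1.
have yR n : y n.+1 * 4 = y n.
  have := zR n.*2; have := zR n.*2.+1; rewrite /y doubleS /= odd_double /=; lia.
have ypow m : y m * 4 ^+ m = y 0%N.
  elim: m => [|m IH]; first by rewrite expr0 mulr1.
  by rewrite -IH -(yR m) exprS; ring.
have y0 n : y n != 0 by rewrite /y; apply/eqP; lia.
have : (4 ^ `|y 0%N| <= `|y 0%N|)%N.
  rewrite -{2}(ypow `|y 0%N|%N) abszM abszX leq_pmull // absz_gt0; exact: y0.
by rewrite leqNgt ltn_expl.
Qed.

Section Main.
Variables (O : Type) (lt : O -> O -> Prop).
Hypothesis Hwo : well_order lt.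
Hypothesis Hreg : regular_uncountable_cardinal lt.
Variables (S : O -> Prop) (eta : O -> nat -> O).
Hypothesis etaP : forall d, S d -> ladder lt d (eta d).
Hypothesis HSnr : non_reflecting lt S.
Variable g : O -> O -> Prop.
Hypothesis gS : forall a b, S a -> g a b -> lt b a.
Hypothesis gP : forall X : O -> Prop, stationary lt (fun=> True)
        (fun a => S a /\ forall b, lt b a -> (X b <-> g a b)).
Variables (pr : O -> O -> O) (on : nat -> O).
Hypothesis prI : forall x y x' y', pr x y = pr x' y' -> x = x' /\ y = y'.
Hypothesis onI : injective on.

(* The points where the first coordinate of the diamond guess is [A]: these stationary
   sets are almost disjoint for different [A]. *)
Definition guessed (A : O -> bool) (d : O) :=
  S d /\ forall x, lt x d -> (A x <-> g d (pr (on 0) x)).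

Definition constrained (RB : (O -> bool) -> Prop) (A : O -> bool) (a : O -> nat -> term O)
  (d : O) :=
  RB A /\ guessed A d.

Variable RB : (O -> bool) -> Prop.

Local Notation KK := (term_group eta (constrained RB)).

Lemma constrainedS A a d : constrained RB A a d -> S d.
Proof. by case=> _ []. Qed.

Lemma term_group_solvable A : RB A -> solvable eta (guessed A) KK.
Proof.
move=> RA a; have /choice [t tP] := cl_surj (eta := eta) (Rl := constrained RB).
pose ta d n := t (a d n).
exists (fun x => cl (Ut A ta x)), (fun d n => cl (Vt A ta d n)) => d Pd n.
by have [_ _ ->] := cl_valuation eta (constrained RB); rewrite // /ta tP.
Qed.

Let op (i : nat) (t s : term O) (x : O) (n : nat) : term O := match i with
  | 0 => Zr
  | 1 => Sb t s
  | 2 => if t is Sb t1 _ then t1 else Zr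
  | 3 => if t is Sb _ t2 then t2 else Zr
  | 4 => match t with Ut A a _ | Vt A a _ _ => Ut A a x | _ => Zr end
  | 5 => match t with Ut A a _ | Vt A a _ _ => Vt A a x n | _ => Zr end
  | _ => match t with Ut A a _ | Vt A a _ _ => a x n | _ => Zr end
  end.

Let index (t : term O) : O := match t with Ut _ _ x | Vt _ _ x _ => x | _ => on 0 end.
Let label (t : term O) : O -> bool :=
  match t with Ut A _ _ | Vt A _ _ _ => A | _ => fun=> false end.

(* The terms [k x] with [x] below [d] play the role of an elementary submodel. *)
Definition adapted (A : O -> bool) (tu k : O -> term O) (d : O) :=
  [/\ limit_ord lt d,
      forall x y, lt x d -> lt y d -> lt (pr x y) d,
      forall n, lt (on n) d,
      forall x, lt x d -> [/\ exists z, lt z d /\ k z = tu x, lt (index (k x)) d &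
        (exists y, label (k x) y <> A y) -> exists y, lt y d /\ label (k x) y <> A y] &
      forall i x y n, lt x d -> lt y d -> exists z, lt z d /\ k z = op i (k x) (k y) y n].

Lemma exists_adapted_club (A : O -> bool) (tu : O -> term O) :
  exists k C, club lt (fun=> True) C /\ forall d, C d -> adapted A tu k d.
Proof.
have [k [kb ko]] := exists_enumeration prI onI tu op.
pose Q x y (j : {i : nat & nat}) z := match j with
  | existT 0 n => k z = tu x
  | existT 1 n => z = pr x y
  | existT 2 n => z = index (k x)
  | existT 3 n => (exists y, label (k x) y <> A y) -> label (k x) z <> A z
  | existT 4 n => z = on n
  | existT i.+4.+1 n => k z = op i (k x) (k y) y n
  end.
have bJ : bounded_index lt {i : nat & nat}.
  by apply: (bounded_index_dep Hwo) => [|_]; apply: (bounded_index_nat Hwo Hreg).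
have Qtot x y j : exists z, Q x y j z.
  case: j => -[|[|[|[|[|i]]]]] n /=; try by eexists.
  - exact: kb.
  - have [[z nz]|N] := pselect (exists y, label (k x) y <> A y); first by exists z.
    by exists x => /N.
  - exact: ko.
exists k; exists (fun d => limit_ord lt d /\ forall x y j, lt x d -> lt y d ->
  exists z, lt z d /\ Q x y j z); split; first exact: (club_closure Hwo Hreg bJ Qtot).
move=> d [dlim dQ]; have [[b bd] _] := dlim; split=> //.
- by move=> x y xd yd; have [z [zd <-]] := dQ x y (existT _ 1%N 0%N) xd yd.
- by move=> n; have [z [zd <-]] := dQ b b (existT _ 4%N n) bd bd.
- move=> x xd; split; first exact: (dQ x x (existT _ 0%N 0%N)).
    by have [z [zd <-]] := dQ x x (existT _ 2%N 0%N) xd xd.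
  by move=> ex; have [z [zd /(_ ex)]] := dQ x x (existT _ 3%N 0%N) xd xd; exists z.
- by move=> i x y n xd yd; apply: (dQ x y (existT _ i.+4.+1 n)).
Qed.

(* Under adaptedness, no ladder at [d] itself constrains a node met before [d]: the label of
   such a node is in [RB], hence differs from [A] already below [d]. *)
Lemma adapted_closed A tu k d b h : ~ RB A -> guessed A d -> adapted A tu k d -> lt d b ->
  (forall c n, S c -> lt d c -> (h c <= n)%N -> lt d (eta c n)) ->
  closed_terms lt eta (constrained RB) b h (fun t => exists x, lt x d /\ k x = t).
Proof.
move=> NA [Sd dA] [dlim dpr don dk dop] db habove.
split=> [t s [x [xd kx]]|B a y [x [xd kx]] c n [RBB [Sc cB]] cb hn cy
  |B a c n [x [xd kx]] [RBB [Sc cB]]].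
- have [z [zd kz]] := dop 2 x x 0%N xd xd; have [w [wd kw]] := dop 3 x x 0%N xd xd.
  by rewrite kx in kz kw; split; [exists z|exists w].
- have [_] := dk x xd; rewrite kx /= => yd labels.
  have cd : lt c d.
    have [//|[E|dc]] := lt_tot Hwo c d.
      case: NA; suff -> : A = B by [].
      apply/funext => z; apply: contrapT => ne; rewrite E in cB.
      have [w [wd]] := labels (ex_intro _ z (fun E' => ne (esym E'))); apply.
      by apply/idP/idP; [move=> /(cB w wd)/(dA w wd)|move=> /(dA w wd)/(cB w wd)].
    have := habove c n Sc dc hn; rewrite cy => dy.
    by case: (lt_irr Hwo (a := d)); apply: (lt_tr Hwo) dy yd.
  split=> [m|].
    by have [z [zd kz]] := dop 5 x c m xd cd; rewrite kx in kz; exists z.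
  by have [z [zd kz]] := dop 6 x c n xd cd; rewrite kx in kz; exists z.
- have [_] := dk x xd; rewrite kx /= => cd _; split=> [|m]; first exact: (lt_tr Hwo) cd db.
  have [_ /(_ m) ec _] := etaP Sc; have ed := lt_tr Hwo ec cd.
  have [z [zd kz]] := dop 5 x c m xd cd; have [w [wd kw]] := dop 4 x (eta c m) m xd ed.
  have [y [yd ky]] := dop 6 x c m xd cd; rewrite kx in kz kw ky.
  by split; [exists z|exists w|exists y].
Qed.

Lemma adapted_recursion A tu k d (w : nat -> KK) : ~ RB A -> guessed A d -> adapted A tu k d ->
  (forall n, w n.+1 *+ 2 = w n + cl (tu (eta d n))) ->
  forall n, exists x, lt x d /\ cl (k x) = w n.
Proof.
move=> NA dA Ad wR; have [Sd _] := dA; have [[[x0 x0d] _] dpr don dk dop] := Ad.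
have /choice [t tP] := cl_surj (eta := eta) (Rl := constrained RB).
have [b [db blow]] := exists_low Hwo Hreg (constrained RB) (fun n => t (w n)) d
  (bounded_index_nat Hwo Hreg).
have [h [hP habove]] := exists_disjoint_tails_above Hwo etaP HSnr b d.
pose Z t := exists x, lt x d /\ k x = t.
have Zc : closed_terms lt eta (constrained RB) b h Z by exact: (adapted_closed NA dA Ad db habove).
have wZ n : zspan (basis lt b h Z) (w n).
  apply: (recursion_in_span Hwo etaP constrainedS hP wR) => m.
    rewrite -[w m]tP; exact: closed_span (low_closed lt eta (constrained RB) b h) (blow m).
  apply: closed_span Zc _; have [_ /(_ m) ed _] := etaP Sd.
  by have [[z zP] _ _] := dk _ ed; exists z.
move=> n; apply: (zspan_min (H := fun y => exists x, lt x d /\ cl (k x) = y) _ _ (wZ n)).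
  have sub y z : (exists x, lt x d /\ cl (k x) = y) -> (exists x, lt x d /\ cl (k x) = z) ->
      exists x, lt x d /\ cl (k x) = y - z :> KK.
    move=> [x [xd <-]] [x' [xd' <-]]; have [u [ud ku]] := dop 1 x x' 0%N xd xd'.
    by exists u; rewrite ku /= cl_sub.
  have zero : exists x, lt x d /\ cl (k x) = 0 :> KK.
    by have [z [zd kz]] := dop 0 x0 x0 0%N x0d x0d; exists z; rewrite kz.
  have neg y : (exists x, lt x d /\ cl (k x) = y :> KK) -> exists x, lt x d /\ cl (k x) = - y :> KK.
    by move=> yP; rewrite -[- y]sub0r; apply: sub.
  by split=> // y z yP zP; rewrite -[z]opprK; apply: sub => //; apply: neg.
by move=> _ [_ [[x [xd <-]] _ ->]]; exists x.
Qed.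

(* The guess at [d] says whether the undeformed recursion along the ladder of [d]
   would be solvable; the deformation [a] is chosen to refute the guess. *)
Lemma term_group_not_solvable A : ~ RB A -> ~ solvable eta (guessed A) KK.
Proof.
move=> NA sol; pose e : KK := cl (Gen (fun=> false)).
pose conv d := exists f : nat -> O, forall n, lt (f n) d /\
  g d (pr (on 1) (pr (eta d n) (pr (f n) (f n.+1)))).
pose a d n : KK := if pselect (conv d) then e *+ (~~ odd n) else 0.
have [u [v uv]] := sol a.
have /choice [t tP] := cl_surj (eta := eta) (Rl := constrained RB).
have [k [C [CC Cad]]] := exists_adapted_club A (fun x => t (u x)).
pose X y := (exists x, A x /\ y = pr (on 0) x) \/
  exists x z z', cl (k z') *+ 2 = cl (k z) + u x /\ y = pr (on 1) (pr x (pr z z')).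
have [d [[Sd dX] /Cad Ad]] := gP X CC.
have [dlim dpr don dk dop] := Ad.
have dA : guessed A d.
  split=> // x xd; rewrite -dX; last exact: dpr.
  split=> [Ax|]; first by left; exists x.
  by move=> [[y [Ay /prI[_ ->]]]|[y [z [z' [_ /prI[/onI]]]]]].
have := uv d dA; rewrite /a; case: pselect => [[f fP]|Nconv] /= vR.
  have kR n : cl (k (f n.+1)) *+ 2 = cl (k (f n)) + u (eta d n).
    have [_ gf] := fP n.
    have /dX : lt (pr (on 1) (pr (eta d n) (pr (f n) (f n.+1)))) d by apply: gS.
    move=> /iffRL /(_ gf) [[x [_ /prI[/onI]]] //|[x [z [z' [E /prI[_ /prI[-> /prI[-> ->]]]]]]]].
    exact: E.
  pose w n := v d n - cl (k (f n)).
  have wR n : w n.+1 *+ 2 = w n + e *+ (~~ odd n).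
    by rewrite /w mulrnBl vR kR addrAC [cl (k (f n)) + _]addrC addrKA addrAC.
  have [F [FA Fe Fw]] := integral_functional Hwo Hreg etaP HSnr constrainedS
    (fun n => t (w n)) (fun=> false) (bounded_index_nat Hwo Hreg).
  have [z zP] := choice Fw; apply: (@no_alternating_recursion z) => n.
  apply: (@intr_inj rat); rewrite intrM mulrzr -zP [RHS]intrD -zP !tP.
  have -> : F (w n.+1) *~ 2 = F (w n.+1 *+ 2) by rewrite pmulrn additive_funMz.
  by rewrite wR (additive_funD FA) pmulrn additive_funMz // Fe; case: odd.
apply: Nconv; have vR' n : v d n.+1 *+ 2 = v d n + cl (t (u (eta d n))) by rewrite vR addr0 tP.
have [f fP] := choice (adapted_recursion NA dA Ad vR'); exists f => n; have [fd fE] := fP n.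
split=> //; have [_ /(_ n) ed _] := etaP Sd.
apply/dX; last by right; exists (eta d n), (f n), (f n.+1); rewrite fE (fP n.+1).2 vR addr0.
exact: dpr (don 1%N) (dpr _ _ ed (dpr _ _ fd (fP n.+1).1)).
Qed.

End Main.

Theorem theoremB (O : Type) (lt : O -> O -> Prop)
  (Hwo : well_order lt) (Hreg : regular_uncountable_cardinal lt)
  (S : O -> Prop) (HS0 : forall a, S a -> cof_omega lt a)
  (HSst : stationary lt (fun _ => True) S) (HSnr : non_reflecting lt S)
  (Hdiam : diamond lt S)
  (M : Type) (HM : (exists f : M -> O, bijective f) \/
                   (exists f : M -> (O -> bool), bijective f))
  (R : M -> M -> Prop) :
  exists G K : M -> zmodType,
    [/\ forall a, lambda_free O (G a) /\ lambda_free O (K a),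
        forall a, exists f : G a -> O, bijective f,
        forall a, exists f : K a -> (O -> bool), bijective f
      & forall a b, Ext_zero (G a) (K b) <-> R a b].
Proof.
have [iota iotaI] : exists f : M -> (O -> bool), injective f.
  case: HM => -[f /bij_inj fI]; last by exists f.
  exists (fun m x => `[< x = f m >]) => m m' E; apply: fI; apply/asboolP.
  by have /= := congr1 (fun h : O -> bool => h (f m)) E; rewrite asboolT // => <-.
have [o] := ord_inhabited Hreg.
have /choice [eta etaP] : forall d, exists f, S d -> ladder lt d f.
  move=> d; have [/HS0 [f fP]|N] := pselect (S d); first by exists f.
  by exists (fun=> o).
have [g [gS gP]] := Hdiam.
have [pr prI] := exists_pairing Hwo Hreg gS gP.
have [on onI] : exists f : nat -> O, injective f.
  by apply: uncountable_nat_injection; case: Hreg.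
pose P (a : M) := guessed lt S g pr on (iota a).
pose Rl (b : M) := constrained lt S g pr on (fun A => exists a, iota a = A /\ R a b).
have PS a d : P a d -> S d by case.
have RlS b A t d : Rl b A t d -> S d by case=> _ [].
exists (fun a => ladder_group eta (P a)), (fun b => term_group eta (Rl b)); split.
- move=> a; split; first exact: (ladder_group_lambda_free Hwo Hreg etaP HSnr (PS a)).
  exact: (term_group_lambda_free Hwo Hreg etaP HSnr (RlS a)).
- by move=> a; apply: ladder_group_card prI onI _ _.
- by move=> b; apply: (term_group_card Hwo Hreg etaP HSnr (RlS b) prI onI).
move=> a b; split=> [Ext0|Rab].
  have sol := solvable_of_Ext_zero (rational_separation Hwo Hreg etaP HSnr (RlS b)) Ext0.
  apply: contrapT => NR.
  apply: (term_group_not_solvable Hwo Hreg etaP HSnr gS gP prI onI _ sol) => -[a' [/iotaI -> //]].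
apply: Ext_zero_of_solvable; apply: term_group_solvable; by exists a.
Qed.
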